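(* Let $\beta=2/\log(e/2)\approx 6.51778$, let $G=\mathcal G(n,p)$ and $m=m(G)$. (i) If $p(n-1)=\beta(\log n-\tfrac12\log\log n)+w(n)$ for some $w(n)\to\infty$, then a.a.s. $A(G)=\lceil m/(n-1)\rceil$. If $pn\to\infty$, then a.a.s. $A(G)\in\{\lceil m/(n-1)\rceil,\lceil m/(n-1)\rceil+1\}$. (ii) If $p=\Theta(1/n)$, then there are constants $0<c_1\le c_2$ such that a.a.s. $(1+c_1)pn/2\le A(G)\le(1+c_2)pn/2$. Moreover, there exists $k=k(n)>0$ (depending on $p$) such that a.a.s. $A(G)\in\{k,k+1\}$. (iii) If $pn\to0$, then a.a.s. $A(G)\le 1$.
   Context: $\mathcal G(n,p)$ is the Erdős–Rényi random graph on $[n]$ with each edge present independently with probability $p=p(n)$; ''a.a.s.'' means with probability tending to $1$ as $n\to\infty$. $m(G)$ is the number of edges of $G$, and the arboricity $A(G)$ is the minimum number of forests (subgraphs of $G$ without cycles) whose edge sets cover $E(G)$. $p=\Theta(1/n)$ means there are constants $0<a\le b$ with $a/n\le p\le b/n$ for all large $n$. *)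

(* Defs.v *)
From HB Require Import structures.
From mathcomp Require Import all_boot all_order all_algebra.
From mathcomp Require Import boolp classical_sets reals topology normedtype sequences exp.
Set Implicit Arguments. Unset Strict Implicit. Unset Printing Implicit Defensive.
Import Order.TTheory GRing.Theory Num.Theory.
Import numFieldNormedType.Exports.

(* Graphs on the vertex set [n] = 'I_n : a graph is its edge set, a set of
   2-element subsets of 'I_n. *)
Definition pairs (n : nat) : {set {set 'I_n}} := [set e : {set 'I_n} | #|e| == 2].

Definition adj n (F : {set {set 'I_n}}) : rel 'I_n := fun x y => [set x; y] \in F.

Definition forest n (F : {set {set 'I_n}}) : Prop :=
  forall s : seq 'I_n, uniq s -> 2 < size s -> ~ cycle (adj F) s.

Definition coverable n (E : {set {set 'I_n}}) (k : nat) : Prop :=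
  exists F : 'I_k -> {set {set 'I_n}},
    (forall i, F i \subset E /\ forest (F i)) /\ E \subset \bigcup_(i < k) F i.

Lemma forest1 n (e : {set 'I_n}) : forest [set e].
Proof.
move=> s us hs cs.
have sub : {subset s <= enum e}.
  move=> x xs; have := next_cycle cs xs; rewrite /adj finset.in_set1 => /eqP <-.
  by rewrite mem_enum set21.
have := uniq_leq_size us sub; rewrite -cardE.
have [x xs] : exists x, x \in s by case: s us hs cs sub => // x ? *; exists x; rewrite inE eqxx.
have := next_cycle cs xs; rewrite /adj finset.in_set1 => /eqP <-.
rewrite cards2; case: (_ != _) => /= h; by move: (leq_trans hs h).
Qed.

Lemma coverable_exists n (E : {set {set 'I_n}}) : exists k, `[< coverable E k >].
Proof.
exists #|E|; apply/asboolP.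
exists (fun i => [set enum_val i]); split.
  by move=> i; split; [rewrite finset.sub1set enum_valP | exact: forest1].
apply/fintype.subsetP => e eE; apply/finset.bigcupP; exists (enum_rank_in eE e) => //.
by rewrite enum_rankK_in // finset.in_set1.
Qed.

Definition arboricity n (E : {set {set 'I_n}}) : nat := ex_minn (coverable_exists E).

Local Open Scope classical_set_scope.
Local Open Scope ring_scope.

(* Probability of an event under G(n,p): each of the pairs is an edge
   independently with probability p. *)
Definition gnp_prob {R : realType} (n : nat) (p : R)
  (P : {set {set 'I_n}} -> Prop) : R :=
  \sum_(E : {set {set 'I_n}} | (E \subset pairs n) && `[< P E >])
     p ^+ #|E| * (1 - p) ^+ (#|pairs n| - #|E|)%N.

Definition aas {R : realType} (p : nat -> R)
  (P : forall n, {set {set 'I_n}} -> Prop) : Prop :=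
  (fun n => gnp_prob (p n) (P n)) @ \oo --> (1 : R).

Definition beta {R : realType} : R := 2 / ln (expR 1 / 2).

Definition ceil_ratio {R : realType} n (E : {set {set 'I_n}}) : int :=
  Num.ceil ((#|E|%:R : R) / (n.-1)%:R).

(* Main.v *)
(** Write e(S) for the number of edges inside S. By Nash-Williams, A(G) <= k iff
    e(S) <= k (|S| - 1) for every nonempty S. To prove it, take a maximal partial
    colouring of the edges by k forests. If some edge stays uncoloured, let R be
    the set of all edges that can become the uncoloured one by successive
    exchanges; every colour class restricted to R spans R, so a component of R
    has too many edges.

    Suppose the average degree d = pn tends to infinity and k = ceil(m/(n-1)). Sets
    S of size at most n/32 satisfy the bound by the first moment method. For
    a larger violating S with complement T, at most about d |T| / 2 edges touch T,
    while many more are expected; by Chernoff and a union bound this is unlikely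
    unless T is small. If A(G) > k + 1 then |T| >= n/(k+1), which is large enough.
    If A(G) > k then T may be small, but the degrees of its vertices add up to
    less than k |T| + e(T), which is impossible when the minimum degree is at
    least k + 2 and small sets are sparse. The threshold beta is the one for
    the minimum degree: the probability of a degree below d/2 + O(1) is at most
    exp(- d / beta) / sqrt d up to a constant.

    If d is bounded, linearly many isolated vertices give the lower bound on A(G).
    For the two values, the maximum over S of e(S) - k (|S| - 1) is concentrated
    within o(n) by the Efron-Stein inequality, so if it vanishes with probability
    not too small, then it is o(n) a.a.s.; the bound with k + 1 can then only
    fail for |S| = o(n), but such sets a.a.s. satisfy e(S) <= 2 (|S| - 1). *)

Require Import Defs.
From HB Require Import structures.
From mathcomp Require Import all_boot all_order all_algebra zify ring lra.
From mathcomp Require Import boolp classical_sets reals topology normedtype sequences exp.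
Set Implicit Arguments. Unset Strict Implicit. Unset Printing Implicit Defensive.
Import Order.TTheory GRing.Theory Num.Theory.
Import numFieldNormedType.Exports.
Import mathcomp.boot.fintype mathcomp.boot.finset.

(** * Forests and connectivity *)

Lemma connect_ind (T : finType) (e : rel T) (P : T -> Prop) x y :
  (forall z w, P z -> e z w -> P w) -> P x -> connect e x y -> P y.
Proof.
move=> Pe Px /connectP[p + ->]; elim: p x Px => //= z p IH x Px /andP[xz zp].
exact: IH (Pe _ _ Px xz) zp.
Qed.

Section Linked.
Variable n : nat.
Implicit Types (F Q E : {set {set 'I_n}}) (e f : {set 'I_n}) (S U : {set 'I_n}).

Lemma adj_sym F : symmetric (adj F).
Proof. by move=> x y; rewrite /adj setUC. Qed.

Lemma adj_csym F : connect_sym (adj F).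
Proof. exact/sym_connect_sym/adj_sym. Qed.

Lemma connect_adjS F Q x y :
  F \subset Q -> connect (adj F) x y -> connect (adj Q) x y.
Proof.
move=> /subsetP FQ; apply: connect_sub => u v uv; apply: connect1.
exact: FQ.
Qed.

Lemma set2_eq (a b x y : 'I_n) :
  [set a; b] = [set x; y] -> (a = x /\ b = y) \/ (a = y /\ b = x).
Proof.
move=> h.
have := set21 a b; rewrite h in_set2 => /orP[] /eqP ax; subst a.
  have := set22 x b; rewrite h in_set2 => /orP[] /eqP bx; last by left.
  by subst b; have := set22 x y; rewrite -h in_set2 orbb => /eqP ->; left.
have := set22 y b; rewrite h in_set2 => /orP[] /eqP bx; first by right.
by subst b; have := set21 x y; rewrite -h in_set2 orbb => /eqP ->; left.
Qed.

(** A simple path crosses the new edge not at all or once, in one of two directions. The three cases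
    together are an invariant of the steps of any path, so no path has to be shortened. *)
Lemma connect_addedge F a b x y :
  connect (adj ([set a; b] |: F)) x y ->
  [\/ connect (adj F) x y,
      connect (adj F) x a /\ connect (adj F) b y |
      connect (adj F) x b /\ connect (adj F) a y].
Proof.
have st z w : adj ([set a; b] |: F) z w ->
  [\/ connect (adj F) z w, z = a /\ w = b | z = b /\ w = a].
  rewrite /adj in_setU1 => /orP[/eqP/set2_eq[[-> ->]|[-> ->]]|zw].
  - by constructor 2.
  - by constructor 3.
  - by constructor 1; apply: connect1.
pose P y := [\/ connect (adj F) x y,
      connect (adj F) x a /\ connect (adj F) b y |
      connect (adj F) x b /\ connect (adj F) a y].
apply: (@connect_ind _ _ P); last by constructor 1.
rewrite /P => z w Pz /st[zw|[zE wE]|[zE wE]]; move: Pz; rewrite ?zE ?wE.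
- case=> [xz|[xa bz]|[xb az]].
  + by constructor 1; apply: connect_trans zw.
  + by constructor 2; split => //; apply: connect_trans zw.
  + by constructor 3; split => //; apply: connect_trans zw.
- case=> [xz|[xa bz]|[xb az]].
  + by constructor 2.
  + by constructor 2.
  + by constructor 1.
- case=> [xz|[xa bz]|[xb az]].
  + by constructor 3.
  + by constructor 1.
  + by constructor 3.
Qed.

(** Stated for a whole set [e], so that an edge can be handled without naming its ends. *)
Definition linked F e := [forall x in e, forall y in e, connect (adj F) x y].

Lemma linked2 F x y : linked F [set x; y] = connect (adj F) x y.
Proof.
apply/'forall_implyP/idP => [/(_ x (set21 _ _))/'forall_implyP|xy z].
  by apply; exact: set22.
rewrite in_set2 => /orP[] /eqP ->; apply/'forall_implyP => w;
 rewrite in_set2 => /orP[] /eqP -> //.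
by rewrite adj_csym.
Qed.

Lemma linkedS F Q e : F \subset Q -> linked F e -> linked Q e.
Proof.
move=> FQ /'forall_implyP h; apply/'forall_implyP => x xe.
apply/'forall_implyP => y ye; apply: (connect_adjS FQ).
by have /'forall_implyP := h x xe; apply.
Qed.

Lemma linked_mem F x y : [set x; y] \in F -> linked F [set x; y].
Proof. by rewrite linked2 => h; apply: connect1. Qed.

Lemma connect_linked F Q x y :
  (forall a b, [set a; b] \in F -> linked Q [set a; b]) ->
  connect (adj F) x y -> connect (adj Q) x y.
Proof.
move=> h; apply: connect_sub => a b /h; by rewrite linked2.
Qed.

Lemma edgeP e : reflect (exists x y, x != y /\ e = [set x; y]) (e \in pairs n).
Proof.
rewrite inE; apply: (iffP (cards2P _)).
  by move=> [x [y [xy ->]]]; exists x, y.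
by move=> [x [y [xy ->]]]; exists x; exists y.
Qed.

(* Equivalent to [forest] for subsets of [pairs n], but avoids cycles. *)
Definition acyclic F := [forall e in F, ~~ linked (F :\ e) e].

Lemma acyclicP F :
  reflect (forall e, e \in F -> ~~ linked (F :\ e) e) (acyclic F).
Proof. exact: 'forall_implyP. Qed.

Lemma acyclicS F Q : F \subset Q -> acyclic Q -> acyclic F.
Proof.
move=> FQ /acyclicP h; apply/acyclicP => e eF.
have := h e (subsetP FQ e eF); apply: contraNN; apply: linkedS.
exact: setSD.
Qed.

(** Without its edge [[set a; b]], a cycle [a, b, c, ...] still leads from [b] to [c] and back to
    [a]; the part after [c] avoids [b], hence also the removed edge. *)
Lemma acyclic_forest F : F \subset pairs n -> acyclic F -> forest F.
Proof.
move=> Fp /acyclicP ac [//|a [//|b [//|c p]]] /= us _ cs.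
move: us cs; rewrite !inE !negb_or -!andbA.
case/and5P => ab ac' ap bc /and3P[bp cp up] /and3P[hab hbc pc].
have /negP := ac _ hab; apply; rewrite linked2 adj_csym.
have hst x y : adj F x y -> b != y -> b != x -> adj (F :\ [set a; b]) x y.
  move=> xy yb xb; rewrite /adj in_setD1 [_ \in F]xy andbT.
  by apply/eqP => /set2_eq[[_ h]|[h _]]; [rewrite h eqxx in yb|rewrite h eqxx in xb].
apply: (@connect_trans _ _ c).
  apply: connect1; rewrite /adj in_setD1 [_ \in F]hbc andbT.
  apply/eqP => /set2_eq[[ba _]|[_ ca]]; first by rewrite ba eqxx in ab.
  by rewrite ca eqxx in ac'.
apply/connectP; exists (rcons p a); last by rewrite last_rcons.
have : b \notin c :: rcons p a.
  by rewrite inE mem_rcons inE !negb_or bc bp eq_sym ab.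
elim: (rcons p a) c pc {hbc ac' bc cp} => //= d q IH c /andP[cd dq].
rewrite !inE !negb_or => /and3P[bc bd bq]; rewrite hst //=.
by apply: IH => //; rewrite inE negb_or bd.
Qed.

(** A simple path linking the ends of [e] without [e] closes with [e] to a cycle; it has a third
    vertex because [e] itself is removed. *)
Lemma forest_acyclic F : F \subset pairs n -> forest F -> acyclic F.
Proof.
move=> Fp fF; apply/acyclicP => e eF.
have /edgeP[a [b [ab eE]]] := subsetP Fp e eF; subst e.
rewrite linked2; apply/negP => /connectP[q /shortenP[p hp up _]] bE.
apply: (fF (a :: p)) => //.
- case: p hp {up} bE => [|c [|d p]] //=.
    by move=> _ ba; rewrite ba eqxx in ab.
  by move=> /andP[h _] bc; move: h; rewrite -bc /adj in_setD1 eqxx.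
- rewrite (cycle_path a) /= -bE adj_sym /adj eF /=.
  by apply: sub_path hp => u v; rewrite /adj in_setD1 => /andP[].
Qed.

(** If deleting an old edge [f] left its ends linked, the linking path would have to use the new
    edge; the rest of that path together with [f] would link the ends of the new edge in [F]. *)
Lemma acyclic_add F e : e \in pairs n -> F \subset pairs n ->
  acyclic F -> ~~ linked F e -> acyclic (e |: F).
Proof.
move=> /edgeP[x [y [xy ->]]] Fp /acyclicP aF.
rewrite linked2 => nxy; apply/acyclicP => f; rewrite in_setU1.
have [->|fe] := eqVneq f [set x; y].
  move=> _; rewrite linked2; apply: contraNN nxy; apply: connect_adjS.
  by apply/subsetP => g; rewrite !inE => /andP[/negPf -> /=].
move=> /= fF; apply/negP.
have /edgeP[a [b [ab fab]]] := subsetP Fp f fF; subst f.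
have sub : F :\ [set a; b] \subset F by exact: subsetDl.
have -> : ([set x; y] |: F) :\ [set a; b] = [set x; y] |: (F :\ [set a; b]).
  apply/setP => g; rewrite !inE; case: (eqVneq g [set x; y]) => [->|//].
  by rewrite eq_sym fe.
rewrite linked2 => /connect_addedge[]; first by rewrite -linked2 (negPf (aF _ fF)).
- move=> [ax yb]; move/negP: nxy; apply.
  apply: (@connect_trans _ _ a); first by rewrite adj_csym (connect_adjS sub).
  apply: (@connect_trans _ _ b); first exact: connect1.
  by rewrite adj_csym (connect_adjS sub).
- move=> [ay xb]; move/negP: nxy; apply.
  apply: (@connect_trans _ _ b); first exact: (connect_adjS sub).
  apply: (@connect_trans _ _ a); first by rewrite adj_csym; apply: connect1.
  exact: (connect_adjS sub).
Qed.

(* A minimal subset of [F] linking [e] consists of edges separating its ends. *)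
Lemma linked_separators F e : F \subset pairs n -> e \in pairs n ->
  acyclic F -> linked F e ->
  linked [set f in F | ~~ linked (F :\ f) e] e.
Proof.
move=> Fp /edgeP[x [y [xy ->]]] /acyclicP aF lF.
have [Q /minsetP[/andP[lQ QF] Qmin] _] :
  {Q | minset (fun Q => linked Q [set x; y] && (Q \subset F)) Q & Q \subset F}.
  by apply: minset_exists; rewrite lF subxx.
apply: linkedS (lQ); apply/subsetP => f fQ.
have fF := subsetP QF f fQ; rewrite inE fF /=.
have nl : ~~ linked (Q :\ f) [set x; y].
  apply/negP => l; have := Qmin (Q :\ f).
  rewrite l (subset_trans (subsetDl _ _) QF) => /(_ isT).
  by rewrite subsetDl => /(_ isT)/setP/(_ f); rewrite !inE eqxx fQ.
have /edgeP[a [b [ab fab]]] := subsetP Fp f fF; subst f.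
apply: contraNN (aF _ fF); rewrite !linked2 => c.
have sub : Q :\ [set a; b] \subset F :\ [set a; b] by exact: setSD.
have : linked ([set a; b] |: (Q :\ [set a; b])) [set x; y].
  by rewrite setD1K.
rewrite linked2 => /connect_addedge[].
- by rewrite -linked2 (negPf nl).
- move=> [/(connect_adjS sub) xa /(connect_adjS sub) yb].
  apply: (@connect_trans _ _ x); first by rewrite adj_csym.
  by apply: (connect_trans c); rewrite adj_csym.
- move=> [/(connect_adjS sub) xb /(connect_adjS sub) ya].
  apply: (@connect_trans _ _ y) => //; rewrite adj_csym.
  by apply: (connect_trans _ c); rewrite adj_csym.
Qed.
End Linked.

(** * The Nash-Williams theorem *)

Section NashWilliams.
Variable n : nat.
Implicit Types (F Q E : {set {set 'I_n}}) (e f : {set 'I_n}) (S U : {set 'I_n}).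

Definition induced E U := [set e in E | e \subset U].

Lemma inducedP E U e : reflect (e \in E /\ e \subset U) (e \in induced E U).
Proof. by rewrite inE; apply: andP. Qed.

Lemma set2_sub (x y : 'I_n) U : ([set x; y] \subset U) = (x \in U) && (y \in U).
Proof. by rewrite subUset !sub1set. Qed.

(** Induction on the number of edges. Deleting an edge [[set a; b]] splits [U] into the component
    [U1] of [a] and the rest [U2], which contains [b]; the strict bounds for both parts leave room
    for the deleted edge. *)
Lemma acyclic_card F U : F \subset pairs n -> acyclic F ->
  (forall e, e \in F -> e \subset U) -> U != set0 -> #|F| < #|U|.
Proof.
have [m] := ubnP #|F|; elim: m F U => // m IH F U Fm Fp aF FU U0.
have [->|/set0Pn[e eF]] := eqVneq F set0.
  by rewrite cards0 card_gt0.
have /edgeP[a [b [ab eE]]] := subsetP Fp e eF.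
pose F' := F :\ e.
have F'F : F' \subset F by exact: subsetDl.
have F'p := subset_trans F'F Fp.
pose U1 := [set z in U | connect (adj F') a z]; pose U2 := U :\: U1.
have cF : #|F| = (#|F'|).+1 by rewrite (cardsD1 e) eF.
have /andP[aU bU] : (a \in U) && (b \in U) by rewrite -set2_sub -eE FU.
have aU1 : a \in U1 by rewrite inE aU connect0.
have bU2 : b \in U2.
  rewrite !inE bU andbT /= -linked2 -eE.
  by have /acyclicP := aF; apply.
have sub1 W : induced F' W \subset F'.
  by apply/subsetP => f /inducedP[].
have h (W : {set 'I_n}) z : z \in W -> #|induced F' W| < #|W|.
  move=> zW; apply: IH.
  - by rewrite -ltnS; apply: leq_trans Fm; rewrite cF !ltnS subset_leq_card.
  - exact: subset_trans (sub1 _) F'p.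
  - exact: acyclicS (sub1 _) (acyclicS F'F aF).
  - by move=> f /inducedP[].
  - by apply/set0Pn; exists z.
have F'E : F' \subset induced F' U1 :|: induced F' U2.
  apply/subsetP => f fF'.
  have /edgeP[u [v [uv fE]]] := subsetP F'p f fF'; subst f.
  have := FU _ (subsetP F'F _ fF'); rewrite set2_sub => /andP[uU vU].
  have uvc : (connect (adj F') a u) = (connect (adj F') a v).
    by apply/idP/idP => h1; apply: connect_trans h1 _; apply: connect1 => //;
      rewrite adj_sym.
  have uvU1 : (u \in U1) = (v \in U1) by rewrite !inE uU vU uvc.
  have uvU2 W : [set u; v] \in induced F' W = (u \in W) && (v \in W).
    by rewrite inE fF' set2_sub.
  rewrite in_setU !uvU2 uvU1 !in_setD uU vU uvU1.
  by case: (v \in U1).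
have := subset_leq_card F'E; have := leq_card_setU (induced F' U1) (induced F' U2).
move=> [hU _] /leq_trans /(_ hU) {}hU.
have := h _ _ aU1; have := h _ _ bU2.
have -> : #|U| = #|U1| + #|U2|.
  rewrite -(cardsID U1 U); congr (_ + _); apply: eq_card => z.
  by rewrite !inE andbA andbb.
move: hU; rewrite cF; clear; lia.
Qed.

(** Take a maximal [W] containing [x0] for which the bound holds. A step leaving [W] would add one
    vertex and at least one edge, contradicting maximality, so [W] is all of [U]. *)
Lemma connected_card Q U x0 : x0 \in U ->
  (forall z, z \in U -> connect (adj (induced Q U)) x0 z) ->
  #|U| <= #|induced Q U|.+1.
Proof.
move=> x0U cU.
pose P (W : {set 'I_n}) := [&& x0 \in W, W \subset U & #|W| <= #|induced Q W|.+1].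
have P0 : P [set x0] by rewrite /P set11 sub1set x0U cards1.
have [W /maxsetP[/and3P[xW WU cW] Wmax] _] := maxset_exists P0.
suff UW : U \subset W by rewrite (_ : U = W) //; apply/eqP; rewrite eqEsubset UW.
apply/subsetP => z /cU; apply: (@connect_ind _ _ (fun z => z \in W)) => //.
move=> u v uW /inducedP[uvQ]; rewrite set2_sub => /andP[uU vU].
apply: contraT => vW.
suff : P (v |: W) by move=> /Wmax /(_ (subsetUr _ _)) h; rewrite -h setU11 in vW.
rewrite /P in_setU1 xW orbT subUset sub1set vU WU /=.
rewrite cardsU1 vW /= add1n ltnS; apply: (leq_trans cW).
have : [set u; v] |: induced Q W \subset induced Q (v |: W).
  apply/subsetP => f; rewrite in_setU1 => /orP[/eqP ->|/inducedP[fQ fW]].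
    by apply/inducedP; split; rewrite // set2_sub !in_setU1 uW eqxx orbT.
  by apply/inducedP; split; rewrite // (subset_trans fW) // subsetUr.
move/subset_leq_card; apply: leq_trans; rewrite cardsU1.
by rewrite !inE set2_sub (negPf vW) !andbF.
Qed.

Variables (k : nat) (E : {set {set 'I_n}}).
Hypothesis Ep : E \subset pairs n.
Let colouring := {ffun {set 'I_n} -> option 'I_k}.
Implicit Types (c : colouring).

Definition colour_class c i := [set f | c f == Some i].
Definition coloured c := [set f | c f != None].
Definition valid_colouring c :=
  [forall i, acyclic (colour_class c i)] && (coloured c \subset E).
Definition recolour c e i : colouring :=
  [ffun f => if f == e then Some i else c f].
Definition uncolour c e' : colouring := [ffun f => if f == e' then None else c f].

Lemma recolour_class c e i j : c e = None ->
  colour_class (recolour c e i) j =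
  if j == i then e |: colour_class c j else colour_class c j.
Proof.
move=> ce; apply/setP => f; case: (eqVneq j i) => [->|ji]; rewrite !inE !ffunE.
  by case: (eqVneq f e) => [->|//]; rewrite eqxx.
case: (eqVneq f e) => [->|//]; rewrite ce; apply/eqP => -[] ij.
by rewrite ij eqxx in ji.
Qed.

Lemma uncolour_class c e i j : c e = Some i ->
  colour_class (uncolour c e) j =
  if j == i then colour_class c j :\ e else colour_class c j.
Proof.
move=> ce; apply/setP => f; case: (eqVneq j i) => [->|ji]; rewrite !inE !ffunE.
  by case: (eqVneq f e).
case: (eqVneq f e) => [->|//]; rewrite ce; apply/esym/eqP => -[] ij.
by rewrite ij eqxx in ji.
Qed.

Lemma class_sub c i : valid_colouring c -> colour_class c i \subset E.
Proof.
move=> /andP[_]; apply: subset_trans; apply/subsetP => f; rewrite !inE.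
by move/eqP->.
Qed.

Lemma class_acyclic c i : valid_colouring c -> acyclic (colour_class c i).
Proof. by move=> /andP[/forallP]. Qed.

Lemma valid_recolour c e i : valid_colouring c -> e \in E -> c e = None ->
  ~~ linked (colour_class c i) e -> valid_colouring (recolour c e i).
Proof.
move=> vc eE ce nl; apply/andP; split.
  apply/forallP => j; rewrite recolour_class //; case: (eqVneq j i) => [->|_].
    apply: acyclic_add (class_acyclic _ vc) nl; first exact: (subsetP Ep).
    exact: subset_trans (class_sub _ vc) Ep.
  exact: class_acyclic.
apply/subsetP => f; rewrite inE ffunE; case: (eqVneq f e) => [->//|_ cf].
by case/andP: vc => _ /subsetP; apply; rewrite inE.
Qed.

Lemma valid_uncolour c e : valid_colouring c -> valid_colouring (uncolour c e).
Proof.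
move=> vc; apply/andP; split.
  apply/forallP => j; apply: acyclicS (class_acyclic j vc).
  by apply/subsetP => f; rewrite !inE ffunE; case: ifP.
apply/subsetP => f; rewrite inE ffunE; case: (eqVneq f e) => [//|_ cf].
by case/andP: vc => _ /subsetP; apply; rewrite inE.
Qed.

(* A state is a partial colouring together with an uncoloured edge [e]; a step
   gives [e] a colour [i] and releases an edge of class [i] separating the
   ends of [e]. *)
Definition exchange_edge c e e' i :=
  (c e' == Some i) && ~~ linked (colour_class c i :\ e') e.
Definition exchange : rel (colouring * {set 'I_n}) := fun s s' =>
  [exists i, exchange_edge s.1 s.2 s'.2 i &&
     (s'.1 == recolour (uncolour s.1 s'.2) s.2 i)].

Definition good_state N (s : colouring * {set 'I_n}) :=
  [&& valid_colouring s.1, s.1 s.2 == None, s.2 \in E & #|coloured s.1| == N].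

(** The edge [e] can join class [i] because the released edge separated its ends; one edge gains a
    colour and one loses it, so the number of coloured edges is kept. *)
Lemma exchange_good N s s' : good_state N s -> exchange s s' -> good_state N s'.
Proof.
case: s s' => [c e] [c' e'] /and4P[/= vc /eqP ce eE /eqP cN].
move=> /existsP[i /andP[/= /andP[/eqP ce' nl] /eqP ->]].
have ee' : e' != e by apply: contraTneq isT => ee'; rewrite ee' ce in ce'.
have ue : uncolour c e' e = None by rewrite ffunE; case: ifP.
have ue' : e' \in E.
  by case/andP: vc => _ /subsetP; apply; rewrite inE ce'.
apply/and4P; split => //=.
- apply: valid_recolour => //; first exact: valid_uncolour.
  by rewrite (uncolour_class _ ce') eqxx.
- by rewrite !ffunE (negPf ee') eqxx.
- rewrite -cN (cardsD1 e) (cardsD1 e' (coloured c)) !inE !ffunE eqxx ce' /=.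
  apply/eqP; congr (_ + _); apply: eq_card => f; rewrite !inE !ffunE.
  case: (eqVneq f e) => [->|fe]; last by case: (eqVneq f e').
  by rewrite ce !andbF.
Qed.
End NashWilliams.

(** * Maximal partial colourings and the exchange argument *)

Section NashWilliamsMain.
Variable n : nat.
Implicit Types (F Q E R : {set {set 'I_n}}) (e f : {set 'I_n}) (S U : {set 'I_n}).

(* Exchanging [e'] for [e] keeps the connectivity inside any [R] containing the
   part of [F] that links [e]. *)
Lemma span_exchange F R e e' x y : F \subset pairs n -> e \in pairs n ->
  e \in R -> e' \in F -> linked (F :&: R) e -> ~~ linked (F :\ e') e ->
  connect (adj ((e |: F :\ e') :&: R)) x y = connect (adj (F :&: R)) x y.
Proof.
move=> Fp ep eR e'F lR nl.
have /edgeP[u [v [uv eE]]] := ep; subst e.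
have /edgeP[a [b [ab e'E]]] := subsetP Fp e' e'F; subst e'.
apply/idP/idP; apply: connect_linked => z w; rewrite in_setI => /andP[+ zwR].
  rewrite in_setU1 in_setD1 => /orP[/eqP ->//|/andP[_ zwF]].
  by apply: linked_mem; rewrite in_setI zwF.
have [-> _|zwe zwF] := eqVneq [set z; w] [set a; b]; last first.
  by apply: linked_mem; rewrite !inE in zwR *; rewrite zwe zwF zwR orbT.
set G := _ :&: R.
have uvG : connect (adj G) u v.
  by apply: connect1; rewrite /adj !inE eqxx eR.
have sub : (F :&: R) :\ [set a; b] \subset G.
  by apply/subsetP => f; rewrite !inE => /and3P[-> -> ->]; rewrite orbT.
have sub' : (F :&: R) :\ [set a; b] \subset F :\ [set a; b].
  by apply: setSD; apply: subsetIl.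
have : connect (adj ([set a; b] |: ((F :&: R) :\ [set a; b]))) u v.
  rewrite -linked2; apply: linkedS lR; apply/subsetP => f; rewrite !inE.
  by move=> ->; rewrite andbT orbN.
rewrite linked2 => /connect_addedge[].
- by move/(connect_adjS sub'); rewrite -linked2 (negPf nl).
- move=> [/(connect_adjS sub) ua /(connect_adjS sub) bv].
  apply: (@connect_trans _ _ u); first by rewrite adj_csym.
  by apply: (connect_trans uvG); rewrite adj_csym.
- move=> [/(connect_adjS sub) ub /(connect_adjS sub) av].
  apply: (connect_trans av); rewrite adj_csym in uvG.
  exact: (connect_trans uvG).
Qed.

Variables (k : nat) (E : {set {set 'I_n}}).
Hypothesis Ep : E \subset pairs n.
Local Notation colouring := {ffun {set 'I_n} -> option 'I_k}.
Implicit Types (c : colouring).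

Lemma exchange_class c c' e e' i j : c e = None -> c e' = Some i ->
  c' = recolour (uncolour c e') e i ->
  colour_class c' j = if j == i then e |: colour_class c j :\ e'
                      else colour_class c j.
Proof.
move=> ce ce' ->; have ue : uncolour c e' e = None by rewrite ffunE; case: ifP.
by rewrite recolour_class // (uncolour_class _ ce'); case: (j == i).
Qed.

(* [R] consists of all edges that exchanges starting at [e0] can leave
   uncoloured; by [span_exchange] the spans of the classes inside [R] never
   change, so they can be computed in the state where a given edge of [R] is the
   uncoloured one. *)
Lemma saturated_edges c0 e0 :
  valid_colouring E c0 -> e0 \in E -> c0 e0 = None ->
  (forall c, valid_colouring E c -> #|coloured c| <= #|coloured c0|) ->
  exists R, [/\ R \subset E, e0 \in R &
    forall i e, e \in R -> linked (colour_class c0 i :&: R) e].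
Proof.
move=> v0 e0E c0e0 cmax; set N := #|coloured c0| in cmax.
pose reach s := connect (@exchange n k) (c0, e0) s.
have good0 : good_state E N (c0, e0) by rewrite /good_state v0 /= c0e0 e0E !eqxx.
have good s : reach s -> good_state E N s.
  by apply: (@connect_ind _ _ (good_state E N)) good0 => z w; apply: exchange_good.
(* Exchanges keep the number of coloured edges maximal, so the uncoloured edge cannot be added to
   any class. *)
have lk c e i : reach (c, e) -> linked (colour_class c i) e.
  move=> /good/and4P[/= vc /eqP ce eE /eqP cN]; apply: contraT => nl.
  have := cmax _ (valid_recolour Ep vc eE ce nl).
  rewrite -cN (_ : coloured (recolour c e i) = e |: coloured c).
    by rewrite cardsU1 inE ce eqxx /= add1n ltnn.
  by apply/setP => f; rewrite !inE ffunE; case: (eqVneq f e).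
pose R := [set e | [exists c, reach (c, e)]].
have inR c e : reach (c, e) -> e \in R by move=> ?; rewrite inE; apply/existsP; exists c.
(* By [linked_separators] the separating edges alone link [e], and each of them lies in [R] because
   it can be exchanged for [e]. *)
have lkR c e i : reach (c, e) -> linked (colour_class c i :&: R) e.
  move=> rc; have /and4P[/= vc /eqP ce eE _] := good _ rc.
  have Cp := subset_trans (class_sub i vc) Ep.
  have := linked_separators Cp (subsetP Ep _ eE) (class_acyclic i vc) (lk _ _ i rc).
  apply: linkedS; apply/subsetP => f; rewrite inE => /andP[fC nl].
  rewrite in_setI fC /=; apply: (inR (recolour (uncolour c f) e i)).
  apply: connect_trans rc _; apply: connect1; apply/existsP; exists i => /=.
  by rewrite /exchange_edge nl andbT eqxx andbT; rewrite inE in fC.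
have inv s : reach s -> reach s /\ forall i x y,
    connect (adj (colour_class s.1 i :&: R)) x y =
    connect (adj (colour_class c0 i :&: R)) x y.
  pose P s := reach s /\ forall i x y,
    connect (adj (colour_class s.1 i :&: R)) x y =
    connect (adj (colour_class c0 i :&: R)) x y.
  apply: (@connect_ind _ _ P); last by split => //; apply: connect0.
  move=> [c e] [c' e'] [rc h] st; split.
    exact: connect_trans rc (connect1 st).
  move=> j x y; rewrite -h /=.
  have /and4P[/= vc /eqP ce eE _] := good _ rc.
  have /existsP[i /andP[/= /andP[/eqP ce' nl] /eqP c'E]] := st.
  rewrite (exchange_class _ ce ce' c'E); case: (eqVneq j i) => [->|//].
  apply: span_exchange nl => //.
  - exact: subset_trans (class_sub i vc) Ep.
  - exact: (subsetP Ep).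
  - exact: inR rc.
  - by rewrite inE ce'.
  - exact: lkR.
exists R; split.
- by apply/subsetP => e; rewrite inE => /existsP[c /good/and4P[]].
- exact: inR (connect0 _ _).
- move=> i e; rewrite inE => /existsP[c rc].
  have [_ h] := inv _ rc; have /and4P[_ _ eE _] := good _ rc.
  have := lkR _ _ i rc; have /edgeP[x [y [xy /= ->]]] := subsetP Ep _ eE.
  by rewrite !linked2 h.
Qed.

(** In a maximal colouring with an uncoloured edge [e0], let [U] be the component of [e0] in [R].
    Each class restricted to [R] connects [U] and so has at least [#|U| - 1] edges in it; together
    with [e0] this exceeds the assumed bound. *)
Lemma valid_colouring_exists :
  (forall U, U != set0 -> #|induced E U| <= k * #|U|.-1) ->
  exists2 c : colouring, valid_colouring E c & coloured c = E.
Proof.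
move=> hE; pose c00 : colouring := [ffun => None].
have v00 : valid_colouring E c00.
  apply/andP; split.
    apply/forallP => i; apply/acyclicP => e; by rewrite inE ffunE.
  by apply/subsetP => e; rewrite inE ffunE.
pose c0 := [arg max_(c > c00 | valid_colouring E c) #|coloured c|].
have [v0 cmax] : valid_colouring E c0 /\
    forall c, valid_colouring E c -> #|coloured c| <= #|coloured c0|.
  by rewrite /c0; case: arg_maxnP.
exists c0 => //; apply/eqP; rewrite eqEsubset; have /andP[_ ->] := v0.
apply/subsetP => e0 e0E; rewrite inE; apply/negP => /eqP c0e0.
have [R [RE e0R lkR]] := saturated_edges v0 e0E c0e0 cmax.
have /edgeP[x0 [y0 [xy0 e0D]]] := subsetP Ep _ e0E.
pose U : {set 'I_n} := [set z | connect (adj R) x0 z].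
have x0U : x0 \in U by rewrite inE connect0.
have U0 : U != set0 by apply/set0Pn; exists x0.
have clU z w : z \in U -> adj R z w -> w \in U.
  by rewrite !inE => h zw; apply: connect_trans h (connect1 zw).
pose Q i := induced (colour_class c0 i :&: R) U.
have cQ i : #|U| <= #|Q i|.+1.
  apply: (connected_card x0U) => z; rewrite inE => h0.
  have {}h0 : connect (adj (colour_class c0 i :&: R)) x0 z.
    by apply: connect_linked h0 => a b abR; apply: lkR.
  pose P z := z \in U /\ connect (adj (Q i)) x0 z.
  suff [] : P z by [].
  apply: (@connect_ind _ _ P) h0; last by split => //; apply: connect0.
  move=> u v [uU cu] uv.
  have uvR : adj R u v by move: uv; rewrite /adj in_setI => /andP[].
  have vU := clU _ _ uU uvR; split => //.
  apply: (connect_trans cu); apply: connect1.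
  by apply/inducedP; rewrite set2_sub uU vU.
have dQ i j : i != j -> [disjoint Q i & Q j].
  move=> ij; rewrite -setI_eq0; apply/eqP/setP => f; rewrite !inE.
  apply/negP => /andP[/andP[/andP[/eqP -> _] _] /andP[/andP[/eqP[h] _] _]].
  by rewrite h eqxx in ij.
have : e0 |: \bigcup_i Q i \subset induced E U.
  apply/subsetP => f; rewrite in_setU1 => /orP[/eqP ->|].
    apply/inducedP; split => //; rewrite e0D set2_sub x0U /=.
    by apply: (clU _ _ x0U); rewrite /adj -e0D.
  move=> /bigcupP[i _ /inducedP[fC fU]]; apply/inducedP; split => //.
  by apply: (subsetP RE); move: fC; rewrite in_setI => /andP[].
have e0Q : e0 \notin \bigcup_i Q i.
  by apply/negP => /bigcupP[i _]; rewrite !inE c0e0.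
move/subset_leq_card; rewrite cardsU1 e0Q add1n.
have -> : #|\bigcup_i Q i| = \sum_(i < k) #|Q i|.
  rewrite -sum1_card partition_disjoint_bigcup //.
  by apply: eq_bigr => i _; rewrite sum1_card.
move=> /leq_trans /(_ (hE _ U0)); apply/negP; rewrite -leqNgt.
rewrite -[k in k * _]card_ord -sum_nat_const; apply: leq_sum => i _.
by rewrite -ltnS prednK // ?(cQ i) // card_gt0.
Qed.

(** Each forest of a cover contributes at most [#|U| - 1] edges inside [U]. Conversely, the classes
    of a full colouring are the covering forests. *)
Lemma coverableP : reflect (forall U, U != set0 -> #|induced E U| <= k * #|U|.-1)
  `[< coverable E k >].
Proof.
apply: (iffP (asboolP _)).
  move=> [F [hF EF]] U U0.
  apply: (@leq_trans #|\bigcup_(i < k) induced (F i) U|).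
    apply: subset_leq_card; apply/subsetP => f /inducedP[/(subsetP EF)].
    move=> /bigcupP[i _ fF] fU; apply/bigcupP; exists i => //; exact/inducedP.
  apply: (@leq_trans (\sum_(i < k) #|induced (F i) U|)).
    elim/big_rec2: _ => [|i m W _ IH]; first by rewrite cards0.
    by apply: leq_trans (leq_card_setU _ _) _; rewrite leq_add2l.
  rewrite -[k in k * _]card_ord -sum_nat_const; apply: leq_sum => i _.
  have [FE fF] := hF i; have Fp := subset_trans FE Ep.
  have sF : induced (F i) U \subset F i by apply/subsetP => f /inducedP[].
  rewrite -ltnS prednK ?card_gt0 //; apply: acyclic_card => //.
  - exact: subset_trans sF Fp.
  - exact: acyclicS sF (forest_acyclic Fp fF).
  - by move=> e /inducedP[].
move=> /valid_colouring_exists[c vc cE]; exists (colour_class c); split.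
  move=> i; split; first exact: class_sub.
  apply: acyclic_forest (class_acyclic i vc).
  exact: subset_trans (class_sub i vc) Ep.
apply/subsetP => e; rewrite -{1}cE inE; case ce: (c e) => [i|] // _.
by apply/bigcupP; exists i => //; rewrite inE ce.
Qed.

End NashWilliamsMain.

Theorem nash_williams n (E : {set {set 'I_n}}) k : E \subset pairs n ->
  reflect (forall U : {set 'I_n}, U != set0 -> #|induced E U| <= k * #|U|.-1)
    (arboricity E <= k).
Proof.
move=> Ep; rewrite /arboricity; case: ex_minnP => a /(coverableP _ Ep) ha amin.
apply: (iffP idP) => [ak U U0|hk]; last by apply/amin/coverableP.
by apply: leq_trans (ha U U0) _; rewrite leq_mul2r ak orbT.
Qed.

Local Open Scope ring_scope.

(** * Random subsets of a finite set *)

Section RandomSubset.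
Context {R : realType} {T : finType}.
Implicit Types (p : R) (D E X : {set T}) (f g : {set T} -> R).

(** Expectation for a random subset of [D] that contains each element independently with probability
    [p]. A general [D], not just [pairs n], permits induction by removing an element. *)
Definition expect p D f : R :=
  \sum_(E : {set T} | E \subset D) p ^+ #|E| * (1 - p) ^+ (#|D| - #|E|)%N * f E.

Lemma eq_expect p D f g : (forall E, E \subset D -> f E = g E) ->
  expect p D f = expect p D g.
Proof. by move=> fg; apply: eq_bigr => E ED; rewrite fg. Qed.

Lemma expect_rec p D f e : e \in D -> expect p D f =
  p * expect p (D :\ e) (fun E => f (e |: E)) + (1 - p) * expect p (D :\ e) f.
Proof.
move=> eD; rewrite /expect (bigID (fun E : {set T} => e \in E)) /=.
have cD : #|D| = #|D :\ e|.+1 by rewrite (cardsD1 e) eD.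
have subD (E : {set T}) : (E \subset D :\ e) = (E \subset D) && (e \notin E).
  by rewrite subsetD1.
congr (_ + _); rewrite big_distrr /=.
  rewrite (reindex_onto (fun E => e |: E) (fun E => E :\ e)) /=; last first.
    by move=> E /andP[_ eE]; rewrite setD1K.
  apply: eq_big => [E|E].
    rewrite setU11 andbT subUset sub1set eD /= subD; congr (_ && _).
    apply/eqP/idP => [<-|eE]; first by rewrite !inE eqxx.
    by rewrite setU1K.
  move=> /andP[/andP[_ _] /eqP EE].
  have eE : e \notin E by rewrite -EE !inE eqxx.
  by rewrite cardsU1 eE cD subSS exprS !mulrA.
apply: eq_big => [E|E /andP[ED eE]]; first by rewrite subD.
have cE : (#|E| <= #|D :\ e|)%N by rewrite subset_leq_card // subD ED.
by rewrite cD subSn // exprS !mulrA [_ * (1 - p)]mulrC.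
Qed.

Lemma expect_set0 p f : expect p set0 f = f set0.
Proof.
rewrite /expect (big_pred1 set0) => [|E]; last by rewrite subset0.
by rewrite cards0 subnn !expr0 !mul1r.
Qed.

Lemma expectD p D f g : expect p D (fun E => f E + g E) = expect p D f + expect p D g.
Proof. by rewrite -big_split /=; apply: eq_bigr => E _; rewrite mulrDr. Qed.

Lemma expectZ p D f c : expect p D (fun E => c * f E) = c * expect p D f.
Proof. by rewrite big_distrr /=; apply: eq_bigr => E _; rewrite mulrCA. Qed.

Lemma expect_sum p D (I : Type) (r : seq I) (P : pred I) (F : I -> {set T} -> R) :
  expect p D (fun E => \sum_(i <- r | P i) F i E) =
  \sum_(i <- r | P i) expect p D (F i).
Proof.
rewrite /expect exchange_big /=; apply: eq_bigr => E _; by rewrite big_distrr.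
Qed.

Lemma set_remove_ind (P : {set T} -> Prop) :
  P set0 -> (forall D e, e \in D -> P (D :\ e) -> P D) -> forall D, P D.
Proof.
move=> P0 PS D; have [m] := ubnP #|D|; elim: m D => // m IH D Dm.
have [->//|/set0Pn[e eD]] := eqVneq D set0.
by apply: (PS _ _ eD); apply: IH; rewrite (cardsD1 e) eD in Dm.
Qed.

Lemma expect_cst p D c : expect p D (fun=> c) = c.
Proof.
elim/set_remove_ind: D => [|D e eD IH]; first by rewrite expect_set0.
by rewrite (expect_rec _ _ eD) IH; ring.
Qed.

Lemma ler_expect p D f g : 0 <= p <= 1 ->
  (forall E, E \subset D -> f E <= g E) -> expect p D f <= expect p D g.
Proof.
move=> /andP[p0 p1] fg; apply: ler_sum => E ED; apply: ler_wpM2l (fg E ED).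
by rewrite mulr_ge0 // exprn_ge0 // subr_ge0.
Qed.

(* Expectation of [g] under the binomial distribution with parameters [M], [p]. *)
Fixpoint binexp p (M : nat) (g : nat -> R) : R :=
  if M is M'.+1 then p * binexp p M' (fun i => g i.+1) + (1 - p) * binexp p M' g
  else g 0%N.

(** Elements of [D] outside [X] average out, so only the [#|X|] independent choices inside [X]
    remain. *)
Lemma expect_card p D X (g : nat -> R) : X \subset D ->
  expect p D (fun E => g #|E :&: X|) = binexp p #|X| g.
Proof.
elim/set_remove_ind: D X g => [|D e eD IH] X g XD.
  by move: XD; rewrite subset0 => /eqP ->; rewrite expect_set0 setI0 cards0.
have XD' : X :\ e \subset D :\ e by apply: setSD.
have h (E : {set T}) : E \subset D :\ e -> E :&: X = E :&: (X :\ e).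
  rewrite subsetD1 => /andP[_ eE]; apply/setP => x; rewrite !inE.
  by case: eqVneq => // ->; rewrite (negPf eE).
rewrite (expect_rec _ _ eD) (cardsD1 e X).
have [eX|eX] := boolP (e \in X).
  rewrite add1n /= -!(IH _ _ XD'); congr (_ * _ + _ * _); apply: eq_expect => E ED.
    rewrite -h // setIUl; have -> : [set e] :&: X = [set e].
      by apply/setIidPl; rewrite sub1set.
    rewrite cardsU1 inE eX andbT; move: ED; rewrite subsetD1 => /andP[_ ->].
    by rewrite add1n.
  by rewrite h.
rewrite add0n -!(IH _ _ XD').
rewrite (_ : expect _ _ (fun E => g #|(e |: E) :&: X|) =
  expect p (D :\ e) (fun E => g #|E :&: (X :\ e)|)).
  rewrite (_ : expect p _ (fun E => g #|E :&: X|) =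
    expect p (D :\ e) (fun E => g #|E :&: (X :\ e)|)); first by ring.
  by apply: eq_expect => E ED; rewrite h.
apply: eq_expect => E ED; rewrite -h // setIUl; have -> : [set e] :&: X = set0.
  by apply/eqP; rewrite setI_eq0 disjoints1.
by rewrite set0U.
Qed.

Lemma binexp_exp p M l : binexp p M (fun i => l ^+ i) = (1 - p + p * l) ^+ M.
Proof.
suff h c : binexp p M (fun i => c * l ^+ i) = c * (1 - p + p * l) ^+ M.
  by rewrite -[RHS]mul1r -h; congr binexp; apply: funext => i; rewrite mul1r.
elim: M c => [|M IH] c /=; first by rewrite !expr0.
rewrite (_ : (fun i => c * l ^+ i.+1) = (fun i => (c * l) * l ^+ i)).
  by rewrite !IH exprS; ring.
by apply: funext => i; rewrite exprS mulrA.
Qed.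

Lemma binexp_cst p M c : binexp p M (fun=> c) = c.
Proof. by elim: M => //= M ->; ring. Qed.

Lemma binexp_pred p M (i : nat) :
  binexp p M (fun j => (j == i)%:R) = 'C(M, i)%:R * p ^+ i * (1 - p) ^+ (M - i)%N.
Proof.
elim: M i => [|M IH] i /=.
  case: i => [|i] /=; first by rewrite bin0 !expr0 !mulr1.
  by rewrite bin0n /= !mul0r.
case: i => [|i].
  rewrite (_ : (fun j => (j.+1 == 0)%N%:R) = (fun=> 0)) // binexp_cst IH.
  by rewrite !bin0 !subn0 exprS; ring.
rewrite (_ : (fun j => (j.+1 == i.+1)%:R) = (fun j => (j == i)%:R)) //.
rewrite !IH binS natrD subSS exprS.
have [lt_iM|] := ltnP i M; last first.
  by move=> h; rewrite (bin_small (n := M) (m := i.+1)) //; ring.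
by rewrite -(subnSK lt_iM) exprS; ring.
Qed.

Lemma ler_binexp p M (g h : nat -> R) : 0 <= p <= 1 ->
  (forall i, (i <= M)%N -> g i <= h i) -> binexp p M g <= binexp p M h.
Proof.
move=> /andP[p0 p1]; elim: M g h => [|M IH] g h gh /=; first exact: gh.
rewrite lerD // ler_wpM2l ?subr_ge0 //; apply: IH => i iM; apply: gh => //.
exact: leqW.
Qed.

Lemma binexp_sum p M (I : Type) (r : seq I) (P : pred I) (F : I -> nat -> R) :
  binexp p M (fun j => \sum_(i <- r | P i) F i j) =
  \sum_(i <- r | P i) binexp p M (F i).
Proof.
elim: M F => //= M IH F; rewrite (IH (fun i j => F i j.+1)) IH.
by rewrite !big_distrr -big_split.
Qed.

(** This is the union bound over the [j]-element subsets of the trials, obtained here by induction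
    from Pascal's rule. *)
Lemma binexp_tail p M (j : nat) : 0 <= p <= 1 ->
  binexp p M (fun i => (j <= i)%N%:R) <= 'C(M, j)%:R * p ^+ j.
Proof.
move=> p01; have /andP[p0 p1] := p01; elim: M j => [|M IH] [|j] /=.
- by rewrite bin0 expr0 mulr1.
- by rewrite mulr_ge0 // exprn_ge0.
- by rewrite !binexp_cst bin0 expr0; lra.
- rewrite (_ : (fun i => (j < i.+1)%N%:R) = (fun i => (j <= i)%N%:R)) //.
  set B1 := binexp p M (fun i => (j < i)%N%:R).
  have B0 : 0 <= B1.
    rewrite -[X in X <= _](binexp_cst p M 0); exact: ler_binexp.
  have h1 := ler_wpM2l p0 (IH j); have h2 : B1 <= _ := IH j.+1.
  have h3 : 0 <= p * B1 by rewrite mulr_ge0.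
  by move: h1 h2 h3; rewrite binS natrD exprS; set x := binexp _ _ _; lra.
Qed.

(* Efron-Stein inequality for functions whose one-element increments are at most
   [L]. *)
Lemma expect_var p D f (L : R) : 0 <= p <= 1 -> 0 <= L ->
  (forall e E, e \in D -> E \subset D :\ e -> `|f (e |: E) - f E| <= L) ->
  expect p D (fun E => f E ^+ 2) <= expect p D f ^+ 2 + L ^+ 2 * p * #|D|%:R.
Proof.
move=> p01 L0; have /andP[p0 p1] := p01.
elim/set_remove_ind: D f => [|D e eD IH] f hf.
  by rewrite !expect_set0 cards0 mulr0 addr0.
rewrite !(expect_rec _ _ eD) (cardsD1 e D) eD natrD.
have sD : D :\ e \subset D by apply: subsetDl.
have h0 : expect p (D :\ e) (fun E => f E ^+ 2) <=
    expect p (D :\ e) f ^+ 2 + L ^+ 2 * p * #|D :\ e|%:R.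
  apply: IH => e' E e'D ED; apply: hf; first exact: (subsetP sD).
  exact: subset_trans ED (setSD _ sD).
have h1 : expect p (D :\ e) (fun E => f (e |: E) ^+ 2) <=
    expect p (D :\ e) (fun E => f (e |: E)) ^+ 2 + L ^+ 2 * p * #|D :\ e|%:R.
  apply: IH => e' E e'D ED; rewrite setUCA; apply: hf; first exact: (subsetP sD).
  have ee' : e' != e by move: e'D; rewrite !inE => /andP[].
  rewrite subUset sub1set !inE eq_sym ee' eD /=.
  exact: subset_trans ED (setSD _ sD).
(* The two conditional means given [e] differ by at most [L]; their variance, [p (1 - p)] times the
   squared difference, is then at most [L ^+ 2 * p]. *)
have : `|expect p (D :\ e) (fun E => f (e |: E)) - expect p (D :\ e) f| <= L.
  have -> : expect p (D :\ e) (fun E => f (e |: E)) - expect p (D :\ e) f =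
      expect p (D :\ e) (fun E => f (e |: E) + (-1) * f E).
    by rewrite expectD expectZ mulN1r.
  have hE E : E \subset D :\ e -> - L <= f (e |: E) + -1 * f E <= L.
    by move=> ED; rewrite mulN1r -ler_norml hf.
  rewrite ler_norml -{1}(expect_cst p (D :\ e) (- L)) -{2}(expect_cst p (D :\ e) L).
  by apply/andP; split; apply: ler_expect => // E /hE /andP[].
move: h0 h1; set m1 := expect p _ (fun E => f (e |: E)); set m0 := expect p _ f.
set a1 := expect p _ _; set a0 := expect p _ _; set V := L ^+ 2 * p * _.
move=> h0 h1 hm.
have hm2 : (m1 - m0) ^+ 2 <= L ^+ 2 by rewrite -real_normK ?num_real // lerXn2r ?nnegrE.
have k1 := ler_wpM2l p0 h1; have q0 : 0 <= 1 - p by lra.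
have k0 := ler_wpM2l q0 h0.
have k2 : p * (1 - p) * (m1 - m0) ^+ 2 <= p * 1 * L ^+ 2.
  apply: ler_pM => //; rewrite ?sqr_ge0 ?mulr_ge0 //.
  by apply: ler_wpM2l => //; lra.
rewrite mulrDr -/V mulr1.
apply: le_trans (lerD k1 k0) _; rewrite -subr_ge0.
rewrite (_ : _ - _ = p * 1 * L ^+ 2 - p * (1 - p) * (m1 - m0) ^+ 2).
  by rewrite subr_ge0.
by ring.
Qed.

(** * Probabilities and the Markov, Chebyshev and Chernoff bounds *)

Definition prob p D (A : {set T} -> Prop) : R :=
  expect p D (fun E => (`[< A E >] : nat)%:R).

Implicit Types A B : {set T} -> Prop.

Lemma prob_markov p D A f : 0 <= p <= 1 -> (forall E, E \subset D -> 0 <= f E) ->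
  (forall E, E \subset D -> A E -> 1 <= f E) -> prob p D A <= expect p D f.
Proof.
move=> p01 f0 f1; apply: ler_expect => // E ED.
by case: asboolP => [/(f1 _ ED)//|_]; apply: f0.
Qed.

Lemma le_prob p D A B : 0 <= p <= 1 ->
  (forall E, E \subset D -> A E -> B E) -> prob p D A <= prob p D B.
Proof.
move=> p01 AB; apply: prob_markov => // E ED.
by move=> /(AB _ ED) BE; rewrite asboolT.
Qed.

Lemma prob_ge0 p D A : 0 <= p <= 1 -> 0 <= prob p D A.
Proof.
move=> p01; rewrite -[X in X <= _](expect_cst p D 0).
exact: ler_expect.
Qed.

Lemma prob_not p D A : prob p D (fun E => ~ A E) = 1 - prob p D A.
Proof.
apply/eqP; rewrite eq_sym subr_eq -expectD; apply/eqP.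
rewrite -[LHS](expect_cst p D 1); apply: eq_expect => E _.
by rewrite asbool_neg; case: asboolP => _ /=; rewrite ?add0r ?addr0.
Qed.

Lemma prob_le1 p D A : 0 <= p <= 1 -> prob p D A <= 1.
Proof. by move=> p01; have := prob_ge0 D (fun E => ~ A E) p01; rewrite prob_not; lra. Qed.

Lemma prob_or p D A B : 0 <= p <= 1 ->
  prob p D (fun E => A E \/ B E) <= prob p D A + prob p D B.
Proof.
move=> p01; rewrite -expectD; apply: prob_markov => // E ED.
  by rewrite addr_ge0.
by case=> h; rewrite (asboolT h) ?lerDl ?lerDr ler0n.
Qed.

Lemma prob_exists p D (I : finType) (P : pred I) (A : I -> {set T} -> Prop) :
  0 <= p <= 1 -> prob p D (fun E => exists2 i, P i & A i E) <=
  \sum_(i | P i) prob p D (A i).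
Proof.
move=> p01; rewrite -expect_sum; apply: prob_markov => // E ED.
  by rewrite sumr_ge0.
move=> [i Pi AiE]; rewrite (bigD1 i) //= asboolT // lerDl.
by rewrite sumr_ge0.
Qed.

Lemma chebyshev p D f (L a : R) : 0 <= p <= 1 -> 0 <= L -> 0 < a ->
  (forall e E, e \in D -> E \subset D :\ e -> `|f (e |: E) - f E| <= L) ->
  prob p D (fun E => a <= `|f E - expect p D f|) <= L ^+ 2 * p * #|D|%:R / a ^+ 2.
Proof.
move=> p01 L0 a0 hf; set m := expect p D f.
have a20 : 0 < a ^+ 2 by rewrite exprn_gt0.
apply: (@le_trans _ _ (expect p D (fun E => (a ^+ 2)^-1 * (f E - m) ^+ 2))).
  apply: prob_markov => // E ED; first by rewrite mulr_ge0 ?invr_ge0 ?sqr_ge0 // ltW.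
  move=> h; rewrite mulrC ler_pdivlMr // mul1r -[X in _ <= X]real_normK ?num_real //.
  by rewrite lerXn2r // nnegrE // ltW.
rewrite expectZ mulrC ler_pM2r ?invr_gt0 //.
rewrite (_ : (fun E => (f E - m) ^+ 2) = (fun E => f E ^+ 2 + (- (2 * m) * f E + m ^+ 2))).
  rewrite !expectD expectZ expect_cst -/m.
  by have := expect_var p01 L0 hf; rewrite -/m; lra.
by apply: funext => E; ring.
Qed.

(** Combine [1 + h <= expR h] with [(1 + h) (1 - h + h ^+ 2) = 1 + h ^+ 3 >= 1]. *)
Lemma expRN_le (h : R) : 0 <= h -> expR (- h) <= 1 - h + h ^+ 2.
Proof.
move=> h0; rewrite expRN -div1r ler_pdivrMr ?expR_gt0 //.
have := expR_ge1Dx h; set y := expR h => hy.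
have q : 0 <= 1 - h + h ^+ 2 by have := sqr_ge0 (h - 1); lra.
have := ler_wpM2l q hy; have : 0 <= h ^+ 3 by rewrite exprn_ge0.
by lra.
Qed.

(** Markov's inequality for [expR (- h)] to the power [#|E :&: X|]; the choice [h = (1 - t) / 2]
    minimises the exponent once [expR (- h)] is replaced by [1 - h + h ^+ 2]. *)
Lemma chernoff_lower p D X (t : R) : 0 <= p <= 1 -> X \subset D -> 0 <= t <= 1 ->
  prob p D (fun E => #|E :&: X|%:R <= t * (p * #|X|%:R)) <=
  expR (- ((1 - t) ^+ 2 / 4 * (p * #|X|%:R))).
Proof.
move=> p01 XD /andP[t0 t1]; have /andP[p0 p1] := p01.
set M := #|X|; pose h := (1 - t) / 2; have h0 : 0 <= h by rewrite /h; lra.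
set c := expR (h * (t * (p * M%:R))).
apply: (@le_trans _ _ (expect p D (fun E => c * expR (- h) ^+ #|E :&: X|))).
  apply: prob_markov => // E ED; first by rewrite mulr_ge0 ?expR_ge0 // exprn_ge0 // expR_ge0.
  move=> hE; rewrite /c -expRM_natr -expRD -[X in X <= _]expR0 ler_expR.
  by have := ler_wpM2l h0 hE; rewrite -/M; lra.
rewrite expectZ (expect_card _ (fun i => expR (- h) ^+ i) XD) binexp_exp -/M.
apply: (@le_trans _ _ (c * expR (p * (expR (- h) - 1)) ^+ M)).
  apply: ler_wpM2l; first exact: expR_ge0.
  apply: lerXn2r; rewrite ?nnegrE ?expR_ge0 //.
    by rewrite addr_ge0 ?mulr_ge0 ?expR_ge0 // subr_ge0.
  by apply: (le_trans _ (expR_ge1Dx _)); lra.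
rewrite /c -expRM_natr -expRD ler_expR.
have := ler_wpM2l p0 (expRN_le h0).
have M0 : 0 <= M%:R :> R by rewrite ler0n.
have tE : t = 1 - 2 * h by rewrite /h; lra.
move/(ler_wpM2r M0); set y := expR (- h); rewrite tE; lra.
Qed.

End RandomSubset.

(** * Union bounds in the random graph *)

Section Bounds.
Context {R : realType}.

Lemma expR1_le4 : expR 1 <= 4 :> R.
Proof.
have h := expR_ge1Dx (- (1 / 2) : R).
have h1 := expRxMexpNx_1 (1 / 2 : R).
have -> : 1 = 1 / 2 + 1 / 2 :> R by lra.
rewrite expRD; set x := expR (1 / 2) in h1 *; have x0 : 0 < x by apply: expR_gt0.
have : x * (1 / 2) <= 1 by rewrite -[X in _ <= X]h1 ler_pM2l //; lra.
by nra.
Qed.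

Lemma exprSn_le (j : nat) : (j.+1%:R : R) ^+ j <= 4 * j%:R ^+ j.
Proof.
case: j => [|j]; first by rewrite !expr0; lra.
have j0 : 0 < j.+1%:R :> R by rewrite ltr0n.
have -> : j.+2%:R = j.+1%:R * (1 + j.+1%:R^-1) :> R.
  by rewrite mulrDr mulr1 divff ?gt_eqF // -natr1.
rewrite exprMn mulrC ler_pM2r ?exprn_gt0 //.
apply: le_trans expR1_le4.
have -> : expR 1 = expR (j.+1%:R^-1) ^+ j.+1 :> R.
  by rewrite -expRM_natl divff ?gt_eqF.
apply: lerXn2r; rewrite ?nnegrE ?expR_ge0 ?expR_ge1Dx //.
by rewrite addr_ge0 // invr_ge0 ler0n.
Qed.

Lemma expnn_le_fact (j : nat) : (j%:R : R) ^+ j <= 4 ^+ j * j`!%:R.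
Proof.
elim: j => [|j IH]; first by rewrite !expr0 fact0 mulr1.
rewrite exprS factS natrM exprS.
have := exprSn_le j; have j0 : 0 <= j.+1%:R :> R by rewrite ler0n.
move/(ler_wpM2l j0)/le_trans; apply.
have := ler_wpM2l j0 IH; lra.
Qed.

Lemma ffact_le_exp (M j : nat) : (M ^_ j <= M ^ j)%N.
Proof.
elim: j M => [|j IH] [|M] //=; rewrite ?ffact0 // ffactSS expnS leq_mul //.
by apply: leq_trans (IH M) _; case: j {IH} => // j; rewrite leq_exp2r.
Qed.

(** The usual bound [(e M / j) ^ j] with [e] replaced by 4, from [j ^ j <= 4 ^ j j!]. *)
Lemma bin_le (M j : nat) : (0 < j)%N ->
  ('C(M, j)%:R : R) <= (4 * M%:R / j%:R) ^+ j.
Proof.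
move=> j0; have jR : 0 < (j%:R : R) by rewrite ltr0n.
rewrite expr_div_n ler_pdivlMr ?exprn_gt0 // exprMn.
apply: (@le_trans _ _ ('C(M, j)%:R * (4 ^+ j * j`!%:R))).
  by rewrite ler_wpM2l ?ler0n // expnn_le_fact.
rewrite mulrCA ler_pM2l ?exprn_gt0 // -natrM bin_ffact -natrX ler_nat.
exact: ffact_le_exp.
Qed.

Lemma bin2R (s : nat) : ('C(s, 2))%:R = s%:R * s.-1%:R / 2 :> R.
Proof.
apply: (@mulIf _ 2); first by rewrite pnatr_eq0.
rewrite divfK ?pnatr_eq0 // -[X in _ * X = _]/(2`!%:R) -!natrM bin_ffact.
by rewrite ffactnS ffactn1.
Qed.

Lemma geom_half_sum (m : nat) : \sum_(s < m) (2^-1 : R) ^+ s <= 2.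
Proof.
suff -> : \sum_(s < m) (2^-1 : R) ^+ s = 2 - 2 * 2^-1 ^+ m.
  by rewrite gerBl mulr_ge0 // exprn_ge0 // invr_ge0.
elim: m => [|m IH]; first by rewrite big_ord0 expr0; lra.
by rewrite big_ord_recr /= IH exprS; lra.
Qed.

End Bounds.

Section Gnp.
Context {R : realType}.
Variables (n : nat) (p : R).
Hypothesis p01 : 0 <= p <= 1.
Implicit Types (E : {set {set 'I_n}}) (S U : {set 'I_n}).
Local Notation Pr := (prob p (pairs n)).

Lemma gnp_probE P : gnp_prob p P = Pr P.
Proof.
rewrite /gnp_prob /prob /expect big_mkcondr /=; apply: eq_bigr => E _.
by case: asboolP => _; rewrite ?mulr1 ?mulr0.
Qed.

Lemma card_inside S : #|induced (pairs n) S| = 'C(#|S|, 2).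
Proof.
rewrite -cards_draws; apply: eq_card => e; rewrite !inE andbC //.
Qed.

Lemma card_pairs : #|pairs n| = 'C(n, 2).
Proof.
rewrite -[n in 'C(n, _)]card_ord -card_draws.
by apply: eq_card => e; rewrite !inE.
Qed.

Lemma induced_setI E S : E \subset pairs n -> induced E S = E :&: induced (pairs n) S.
Proof.
move=> /subsetP Ep; apply/setP => e.
apply/inducedP/setIP => [[eE eS]|[eE /inducedP[_ eS]]]; split => //.
by apply/inducedP; split=> //; exact: Ep.
Qed.

(** Union bound over [S], grouped by size: each size [s] contributes at most [d / 2 ^ s], and the
    geometric sum is at most 2. *)
Lemma prob_exists_size (c : pred nat) (bad : {set 'I_n} -> {set {set 'I_n}} -> Prop) (d : R) :
  0 <= d ->
  (forall S, c #|S| -> 'C(n, #|S|)%:R * Pr (bad S) <= d * 2^-1 ^+ #|S|) ->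
  Pr (fun E => exists2 S : {set 'I_n}, c #|S| & bad S E) <= 2 * d.
Proof.
move=> d0 hbad; apply: le_trans (prob_exists _ _ _ p01) _.
apply: (@le_trans _ _ (\sum_(S : {set 'I_n}) d * 2^-1 ^+ #|S| / 'C(n, #|S|)%:R)).
  rewrite big_mkcond /=; apply: ler_sum => S _.
  have C0 : 0 < ('C(n, #|S|)%:R : R).
    by rewrite ltr0n bin_gt0 -[n in (_ <= n)%N]card_ord max_card.
  case: ifP => [cS|_]; last by rewrite divr_ge0 ?(ltW C0) // mulr_ge0 // exprn_ge0 // invr_ge0.
  by rewrite ler_pdivlMr // mulrC hbad.
have leS S : (#|S| < n.+1)%N by rewrite ltnS -[n in (_ <= n)%N]card_ord max_card.
rewrite (partition_big (fun S => Ordinal (leS S)) xpredT) //=.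
rewrite [X in _ <= X]mulrC.
apply: (@le_trans _ _ (d * \sum_(s < n.+1) 2^-1 ^+ s)); last first.
  by rewrite ler_wpM2l // geom_half_sum.
rewrite big_distrr /=; apply: ler_sum => s _.
have C0 : 0 < ('C(n, s)%:R : R) by rewrite ltr0n bin_gt0 -ltnS.
rewrite (eq_bigr (fun=> d * 2^-1 ^+ s / 'C(n, s)%:R)) => [|S /eqP <-] //.
rewrite sumr_const -[X in X <= _]mulr_natr (_ : #|_| = 'C(n, s)).
  by rewrite divfK ?gt_eqF.
rewrite -[n in 'C(n, _)]card_ord -card_draws; apply: eq_card => S.
by rewrite !inE.
Qed.

(** Union bound over the choices of [j = K (s - 1) + 1] pairs inside [S]; the base comes from
    [4 C(s, 2) / j <= 2 s / K]. *)
Lemma prob_dense S (K : nat) : (0 < K)%N -> (1 < #|S|)%N ->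
  Pr (fun E => K * #|S|.-1 < #|induced E S|)%N <=
  (2 * #|S|%:R * p / K%:R) ^+ (K * #|S|.-1).+1.
Proof.
move=> K0 S1; set s := #|S| in S1 *; set j := (K * s.-1).+1.
have /andP[p0 p1] := p01.
have sub : induced (pairs n) S \subset pairs n.
  by apply/subsetP => e /inducedP[].
apply: (@le_trans _ _ ('C('C(s, 2), j)%:R * p ^+ j)).
  rewrite /s -card_inside; apply: le_trans (binexp_tail _ _ p01).
  rewrite -(expect_card _ (fun i => (j <= i)%N%:R) sub).
  apply: prob_markov => // E ED.
  by rewrite induced_setI // => ->.
have KR : 0 < K%:R :> R by rewrite ltr0n.
have sR : 0 < s.-1%:R :> R by rewrite ltr0n -subn1 subn_gt0.
apply: (@le_trans _ _ ((4 * ('C(s, 2))%:R / j%:R) ^+ j * p ^+ j)).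
  by rewrite ler_wpM2r ?exprn_ge0 // bin_le.
rewrite -exprMn; apply: lerXn2r; rewrite ?nnegrE ?mulr_ge0 ?invr_ge0 ?ler0n //.
rewrite [X in _ <= X]mulrAC; apply: ler_wpM2r => //.
have jE : j%:R = K%:R * s.-1%:R + 1 :> R by rewrite /j -natr1 natrM.
rewrite bin2R ler_pdivlMr // mulrAC ler_pdivrMr ?ltr0n // jE.
move: KR sR (ler0n R s); clear; set x := _.-1%:R; set y := s%:R; set z := K%:R.
by move=> *; nra.
Qed.
End Gnp.

(** * First moment bounds for sets with too many edges *)

Section Sparse.
Context {R : realType}.
Variables (n : nat) (p : R).
Hypothesis p01 : 0 <= p <= 1.
Implicit Types (E : {set {set 'I_n}}) (S U T : {set 'I_n}).
Local Notation Pr := (prob p (pairs n)).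
Local Notation N := (n%:R : R).

Lemma exprn_le_id (x : R) (s : nat) : 0 <= x <= 1 -> (0 < s)%N -> x ^+ s <= x.
Proof.
move=> /andP[x0 x1]; case: s => // s _; rewrite exprS -[X in _ <= X]mulr1.
by rewrite ler_wpM2l // exprn_ile1.
Qed.

Lemma prob_exists_dense (c : pred nat) (K : nat) (d : R) : (0 < K)%N -> 0 <= d ->
  (forall s, c s -> (s <= n)%N -> (1 < s)%N /\
     (4 * N / s%:R) ^+ s * (2 * s%:R * p / K%:R) ^+ (K * s.-1).+1 <= d * 2^-1 ^+ s) ->
  Pr (fun E => exists2 S : {set 'I_n}, c #|S| & K * #|S|.-1 < #|induced E S|)%N <= 2 * d.
Proof.
move=> K0 d0 h; have /andP[p0 p1] := p01; apply: prob_exists_size => // S cS.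
have Sn : (#|S| <= n)%N by rewrite -[n in (_ <= n)%N]card_ord max_card.
have [S1 hS] := h _ cS Sn; apply: le_trans hS; apply: ler_pM; rewrite ?ler0n ?prob_ge0 //.
  by apply: bin_le; apply: ltnW.
exact: prob_dense.
Qed.

(** For [K = 1] both exponents equal [s], and the two bases multiply to [8 N p <= d / 2]. *)
Lemma prob_cyclic (d : R) : 0 <= d <= 1 -> 16 * (N * p) <= d ->
  Pr (fun E => exists2 S : {set 'I_n}, (1 < #|S|)%N & 1 * #|S|.-1 < #|induced E S|)%N <= 2 * d.
Proof.
move=> /andP[d0 d1] hd; have /andP[p0 p1] := p01.
apply: (@prob_exists_dense (fun s => 1 < s)%N) => // s s1 sn; split => //.
have s0 : 0 < s%:R :> R by rewrite ltr0n ltnW.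
rewrite mul1n prednK ?(ltnW s1) // -!exprMn.
apply: (@le_trans _ _ ((d * 2^-1) ^+ s)).
  apply: lerXn2r; rewrite ?nnegrE.
  - by rewrite !mulr_ge0 ?invr_ge0 ?ler0n.
  - by rewrite mulr_ge0 ?invr_ge0.
  - rewrite [X in X <= _](_ : _ = 8 * (N * p)); first by lra.
    by field; rewrite gt_eqF.
rewrite exprMn ler_wpM2r ?exprn_ge0 ?invr_ge0 //.
by apply: exprn_le_id; rewrite ?d0 // ltnW.
Qed.

Lemma ler_natr_exp2 (s : nat) : s%:R <= 2 ^+ s :> R.
Proof. by rewrite -natrX ler_nat ltnW // ltn_expl. Qed.

(** Since [K >= 4], the exponent is at least [2 s]; with [u = s / n] the bound becomes
    [(u / 4) ^ s], which is at most [1 / (2 ^ s n)]. *)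
Lemma prob_dense_const (K : nat) : (0 < n)%N -> (4 <= K)%N -> 8 * (N * p) <= K%:R ->
  Pr (fun E => exists2 S : {set 'I_n}, (1 < #|S|)%N & K * #|S|.-1 < #|induced E S|)%N <= 2 * N^-1.
Proof.
move=> n0 K4 hK; have /andP[p0 p1] := p01.
have N0 : 0 < N by rewrite ltr0n.
have K0 : (0 < K)%N by apply: leq_trans K4.
apply: (@prob_exists_dense (fun s => 1 < s)%N) => //; first by rewrite invr_ge0 ltW.
move=> s s1 sn; split => //.
have s0 : 0 < s%:R :> R by rewrite ltr0n ltnW.
have KR : 0 < K%:R :> R by rewrite ltr0n.
pose u : R := s%:R / N; have u0 : 0 < u by rewrite divr_gt0.
have u1 : u <= 1 by rewrite ler_pdivrMr // mul1r ler_nat.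
have xu : 2 * s%:R * p / K%:R <= u / 4.
  rewrite ler_pdivrMr // (_ : u / 4 * _ = s%:R * K%:R / 4 / N); last first.
    by rewrite /u; field; rewrite gt_eqF.
  rewrite ler_pdivlMr //.
  have := ler_wpM2l (ltW s0) hK; lra.
set x := _ * p / _ in xu *; have x0 : 0 <= x by rewrite /x !mulr_ge0 ?invr_ge0 ?ler0n.
have -> : 4 * N / s%:R = 4 / u by rewrite /u; field; rewrite !gt_eqF.
apply: (@le_trans _ _ ((4 / u) ^+ s * (u / 4) ^+ (2 * s))).
  rewrite ler_wpM2l ?exprn_ge0 ?divr_ge0 ?(ltW u0) //.
  apply: (@le_trans _ _ (x ^+ (2 * s))).
    apply: ler_wiXn2l => //; first by lra.
    by clear - K4 s1; nia.
  by apply: lerXn2r; rewrite ?nnegrE // divr_ge0 // ltW.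
rewrite exprM mulrC -exprMn.
rewrite (_ : (u / 4) ^+ 2 * (4 / u) = u * (2^-1 * 2^-1)); last by field; rewrite gt_eqF.
rewrite mulrA 2!exprMn ler_wpM2r ?exprn_ge0 ?invr_ge0 //.
apply: (@le_trans _ _ (u * 2^-1 ^+ s)).
  apply: ler_wpM2r; first by rewrite exprn_ge0 // invr_ge0.
  by apply: exprn_le_id; rewrite ?(ltW u0) // ltnW.
rewrite /u mulrAC ler_pdivrMr // mulVf ?gt_eqF // exprVn ler_pdivrMr ?exprn_gt0 //.
by rewrite mul1r ler_natr_exp2.
Qed.

(** With [u = s / n], [x = u N p] and [t = s - 1], the bound is [(4 x / u) (4 x ^ 2 / u) ^ t]. The
    first factor is at most [4 D]; the others are of order [D ^ 2 u], so a single one of them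
    already compensates for it. *)
Lemma prob_dense2 (D s0 d : R) : (0 < n)%N -> 1 <= D -> N * p <= D ->
  0 <= d <= 1 -> 64 * D ^+ 3 * s0 <= d * N ->
  Pr (fun E => exists2 S : {set 'I_n}, (1 < #|S|)%N && (#|S|%:R <= s0)%R &
                          2 * #|S|.-1 < #|induced E S|)%N <= 2 * d.
Proof.
move=> n0 D1 hD /andP[d0 d1] hs0; have /andP[p0 p1] := p01.
have N0 : 0 < N by rewrite ltr0n.
apply: (@prob_exists_dense (fun s => (1 < s)%N && (s%:R <= s0))) => //.
move=> s /andP[s1 ss0] sn; split => //.
have sp : 0 < s%:R :> R by rewrite ltr0n ltnW.
pose u : R := s%:R / N; have u0 : 0 < u by rewrite divr_gt0.
have hu : 64 * D ^+ 3 * u <= d.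
  rewrite /u mulrA ler_pdivrMr //; apply: le_trans hs0.
  by rewrite ler_wpM2l // mulr_ge0 // exprn_ge0 //; lra.
have D23 : D ^+ 2 <= D ^+ 3 by rewrite ler_weXn2l.
have hu2 : 8 * D ^+ 2 * u <= 1.
  have := ler_wpM2r (ltW u0) D23; have : 0 <= D ^+ 3 * u.
    by rewrite mulr_ge0 ?(ltW u0) // exprn_ge0 //; lra.
  lra.
have Np0 : 0 <= N * p by rewrite mulr_ge0 // ltW.
have -> : 2 * s%:R * p / 2 = u * (N * p) by rewrite /u; field; rewrite gt_eqF.
have -> : 4 * N / s%:R = 4 / u by rewrite /u; field; rewrite !gt_eqF.
have -> : s = s.-1.+1 by rewrite prednK // ltnW.
have t1 : (0 < s.-1)%N by rewrite -subn1 subn_gt0.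
move: s.-1 t1 => t t1 /=; clearbody u.
set x := u * (N * p); have x0 : 0 <= x by rewrite mulr_ge0 // ltW.
rewrite [X in X * _ <= _]exprS [X in _ * X <= _]exprS exprM.
have e1 : 4 / u * x <= 4 * D.
  have -> : 4 / u * x = 4 * (N * p) by rewrite /x; field; rewrite gt_eqF.
  by rewrite ler_wpM2l.
have e2 : 4 / u * x ^+ 2 <= (8 * D ^+ 2 * u) * 2^-1.
  have -> : 4 / u * x ^+ 2 = 4 * u * (N * p) ^+ 2.
    by rewrite /x; field; rewrite gt_eqF.
  have : (N * p) ^+ 2 <= D ^+ 2 by rewrite lerXn2r ?nnegrE //; lra.
  by move/(ler_wpM2l (ltW u0)); lra.
rewrite [X in X <= _](_ : _ = (4 / u * x) * (4 / u * x ^+ 2) ^+ t); last first.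
  by rewrite mulrACA -exprMn.
apply: (@le_trans _ _ (4 * D * (8 * D ^+ 2 * u * 2^-1) ^+ t)).
  apply: ler_pM => //; rewrite ?exprn_ge0 ?mulr_ge0 ?invr_ge0 ?(ltW u0) //.
  by apply: lerXn2r; rewrite ?nnegrE ?mulr_ge0 ?exprn_ge0 ?invr_ge0 ?(ltW u0) //; lra.
have e3 : 4 * D * (8 * D ^+ 2 * u) ^+ t <= 4 * D * (8 * D ^+ 2 * u).
  apply: ler_wpM2l; first by lra.
  by apply: exprn_le_id => //; rewrite hu2 !mulr_ge0 ?exprn_ge0 ?(ltW u0) //; lra.
have e4 : 4 * D * (8 * D ^+ 2 * u) <= d * 2^-1 by lra.
have f0 : 0 <= 2^-1 ^+ t :> R by rewrite exprn_ge0 // invr_ge0.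
have := ler_wpM2r f0 (le_trans e3 e4).
by rewrite [(_ * 2^-1) ^+ t]exprMn [2^-1 ^+ t.+1]exprS !mulrA.
Qed.

(** As [K >= 2 L], the exponent is at least [L s]. For each vertex, one factor [8 u] cancels the
    count of sets and the other [L - 1] are at most [1 / 4] because [s <= n / 32]. *)
Lemma prob_dense_small (K L : nat) (d : R) : (0 < n)%N -> (0 < L)%N -> (2 * L <= K)%N ->
  N * p <= 4 * K%:R -> 0 <= d <= 1 -> 64 <= d * 4 ^+ L.-1 ->
  Pr (fun E => exists2 S : {set 'I_n}, (1 < #|S|)%N && (32 * #|S| <= n)%N &
                          K * #|S|.-1 < #|induced E S|)%N <= 2 * d.
Proof.
move=> n0 L0 LK hK /andP[d0 d1] hL; have /andP[p0 p1] := p01.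
have N0 : 0 < N by rewrite ltr0n.
have K0 : (0 < K)%N by apply: leq_trans LK; rewrite muln_gt0.
have KR : 0 < K%:R :> R by rewrite ltr0n.
apply: (@prob_exists_dense (fun s => (1 < s)%N && (32 * s <= n)%N)) => //.
move=> s /andP[s1 sn] _; split => //.
have s0 : 0 < s%:R :> R by rewrite ltr0n ltnW.
pose u : R := s%:R / N; have u0 : 0 < u by rewrite divr_gt0.
have u1 : 8 * u <= 4^-1.
  have : 32 * s%:R <= N by rewrite -natrM ler_nat.
  by rewrite /u mulrA ler_pdivrMr //; lra.
have xu : 2 * s%:R * p / K%:R <= 8 * u.
  rewrite ler_pdivrMr // (_ : 8 * u * _ = 8 * s%:R * K%:R / N); last first.
    by rewrite /u; field; rewrite gt_eqF.
  rewrite ler_pdivlMr //.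
  by have := ler_wpM2l (ltW s0) hK; lra.
set x := _ * p / _ in xu *; have x0 : 0 <= x by rewrite /x !mulr_ge0 ?invr_ge0 ?ler0n.
have -> : 4 * N / s%:R = 4 / u by rewrite /u; field; rewrite !gt_eqF.
have u8 : 0 <= 8 * u by rewrite mulr_ge0 // ltW.
apply: (@le_trans _ _ ((4 / u) ^+ s * (8 * u) ^+ (L * s))).
  rewrite ler_wpM2l ?exprn_ge0 ?divr_ge0 ?(ltW u0) //.
  apply: (@le_trans _ _ (x ^+ (L * s))).
    apply: ler_wiXn2l => //; first by lra.
    by clear - LK s1; nia.
  by apply: lerXn2r; rewrite ?nnegrE.
rewrite exprM -exprMn.
have LE : L = L.-1.+1 by rewrite prednK.
rewrite {1}LE exprS (_ : 4 / u * _ = 32 * (8 * u) ^+ L.-1); last first.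
  by field; rewrite gt_eqF.
apply: (@le_trans _ _ ((d * 2^-1) ^+ s)).
  apply: lerXn2r; rewrite ?nnegrE ?mulr_ge0 ?exprn_ge0 ?invr_ge0 ?(ltW u0) //.
  have : (8 * u) ^+ L.-1 <= 4^-1 ^+ L.-1 by rewrite lerXn2r ?nnegrE ?invr_ge0.
  have f0 : 0 < 4 ^+ L.-1 :> R by rewrite exprn_gt0.
  move: hL; rewrite -ler_pdivrMr // -exprVn; lra.
rewrite exprMn ler_wpM2r ?exprn_ge0 ?invr_ge0 //.
by apply: exprn_le_id; rewrite ?d0 // ltnW.
Qed.

End Sparse.

(* [(1 - 127/128)^2 / 4] from [chernoff_lower], halved because [touching T] has at
   least [#|T| n / 2] elements when [#|T| <= 31 n / 32]. *)
Definition rate {R : realType} : R := 512^-1 / 256.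

(** * Edges touching a vertex set, and isolated vertices *)

Section Touching.
Context {R : realType}.
Variables (n : nat) (p : R).
Hypothesis p01 : 0 <= p <= 1.
Implicit Types (E : {set {set 'I_n}}) (S U T : {set 'I_n}).
Local Notation Pr := (prob p (pairs n)).
Local Notation N := (n%:R : R).

(** The pairs with an end in [T], written as a complement so that every edge set splits into the
    edges touching [T] and those inside [~: T]. *)
Definition touching T := pairs n :\: induced (pairs n) (~: T).

Lemma touching_sub T : touching T \subset pairs n.
Proof. exact: subsetDl. Qed.

Lemma card_setI_touching E T : E \subset pairs n ->
  (#|E :&: touching T| + #|induced E (~: T)|)%N = #|E|.
Proof.
move=> Ep; rewrite induced_setI // -(cardsID (induced (pairs n) (~: T)) E) addnC.
congr (_ + _)%N; apply: eq_card => e; rewrite inE [RHS]inE [e \in touching T]inE.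
rewrite andbC andbAC.
by case: (boolP (e \in E)) => [/(subsetP Ep) ->|]; rewrite ?andbF ?andbT.
Qed.

Lemma card_touching T :
  #|touching T|%:R = #|T|%:R * (2 * N - #|T|%:R - 1) / 2 :> R.
Proof.
have := card_setI_touching T (subxx (pairs n)).
have /setIidPr -> : touching T \subset pairs n by apply: touching_sub.
rewrite card_inside card_pairs; have := cardsC T; rewrite card_ord.
set t := #|T|; set s := #|~: T| => ts h.
have predR (k : nat) : k%:R * k.-1%:R = k%:R * (k%:R - 1) :> R.
  by case: k => [|k]; rewrite ?mul0r //= -natr1 addrK.
have tsR : N = t%:R + s%:R by rewrite -natrD ts.
have := congr1 (fun k => k%:R : R) h; rewrite natrD !bin2R !predR tsR.
by lra.
Qed.

(** At least [(1 + 1 / 64) n #|T| / 2] pairs touch [T], so the event lies below [1 - 1 / 128] times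
    the mean, because [(1 - 1 / 128) (1 + 1 / 64) >= 1 + 1 / 256]. *)
Lemma prob_touching T : 64 <= N -> 32 * #|T|%:R <= 31 * N ->
  Pr (fun E => #|E :&: touching T|%:R <= (1 + 256^-1) * (N * p) * #|T|%:R / 2) <=
  expR (- (rate * (N * p))) ^+ #|T|.
Proof.
move=> n64 hT; have /andP[p0 p1] := p01.
set t : R := #|T|%:R; have t0 : 0 <= t by rewrite ler0n.
pose M := #|touching T|%:R : R.
have ME : M = t * (2 * N - t - 1) / 2 by rewrite /M card_touching.
have hM : t * N * (1 + 64^-1) / 2 <= M.
  by rewrite ME; have := ler_wpM2l t0 hT; rewrite -/t; have := ler_wpM2l t0 n64; lra.
pose th : R := 1 - 128^-1.
have th01 : 0 <= th <= 1 by rewrite /th; lra.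
have pM := ler_wpM2l p0 hM.
have ptN : 0 <= p * (t * N) by rewrite !mulr_ge0 //; lra.
apply: (@le_trans _ _ (Pr (fun E => #|E :&: touching T|%:R <= th * (p * M)))).
  apply: le_prob => // E ED h; apply: le_trans h _; rewrite /th; lra.
apply: le_trans (chernoff_lower p01 (touching_sub T) th01) _.
rewrite -expRM_natr ler_expR -/M -/t /th /rate; lra.
Qed.

(** The union bound has base [4 N expR (- (rate N p)) / t], and [t >= t1] makes it at most
    [d / 2]. *)
Lemma prob_exists_touching (t1 d : R) : 64 <= N -> 0 < t1 -> 0 <= d <= 1 ->
  8 * N * expR (- (rate * (N * p))) <= d * t1 ->
  Pr (fun E => exists2 T : {set 'I_n},
      [&& (0 < #|T|)%N, t1 <= #|T|%:R & 32 * #|T|%:R <= 31 * N] &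
      #|E :&: touching T|%:R <= (1 + 256^-1) * (N * p) * #|T|%:R / 2) <= 2 * d.
Proof.
move=> n64 t10 /andP[d0 d1] hd.
apply: (@prob_exists_size R n p p01
  (fun t => [&& (0 < t)%N, t1 <= t%:R & 32 * t%:R <= 31 * N])) => //.
move=> T /and3P[T0 tT T31]; set t := #|T| in T0 tT T31 *.
have tR : 0 < t%:R :> R by rewrite ltr0n.
apply: (@le_trans _ _ ((4 * N / t%:R) ^+ t * expR (- (rate * (N * p))) ^+ t)).
  apply: ler_pM; rewrite ?ler0n ?prob_ge0 ?bin_le //.
  exact: prob_touching.
rewrite -exprMn; set x := expR _ in hd *; have x0 : 0 < x by apply: expR_gt0.
apply: (@le_trans _ _ ((d * 2^-1) ^+ t)).
  apply: lerXn2r; rewrite ?nnegrE ?mulr_ge0 ?invr_ge0 ?ler0n ?(ltW x0) //.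
  rewrite mulrAC ler_pdivrMr //.
  by have := ler_wpM2l d0 tT; lra.
rewrite exprMn ler_wpM2r ?exprn_ge0 ?invr_ge0 //.
by apply: exprn_le_id; rewrite ?d0.
Qed.

Lemma binexp_id (q : R) (M : nat) : binexp q M (fun i => i%:R) = q * M%:R.
Proof.
suff h c : binexp q M (fun i => c + i%:R) = c + q * M%:R.
  by rewrite -[RHS]add0r -h; congr binexp; apply: funext => i; rewrite add0r.
elim: M c => [|M IH] c /=; first by rewrite mulr0.
rewrite (_ : (fun i => c + i.+1%:R) = (fun i => (c + 1) + i%:R)).
  by rewrite !IH -[M.+1%:R]natr1; ring.
by apply: funext => i; rewrite -natr1; ring.
Qed.

Lemma expect_edges : expect p (pairs n) (fun E => #|E|%:R) = p * #|pairs n|%:R.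
Proof.
rewrite -binexp_id -(expect_card p (fun i => i%:R) (subxx (pairs n))).
by apply: eq_expect => E /setIidPl ->.
Qed.

Lemma prob_edges (a : R) : 0 < a ->
  Pr (fun E => a <= `|#|E|%:R - p * #|pairs n|%:R|) <= p * #|pairs n|%:R / a ^+ 2.
Proof.
move=> a0; rewrite -expect_edges; apply: le_trans (chebyshev (L := 1) p01 _ a0 _) _ => //.
- move=> e E eD; rewrite subsetD1 => /andP[_ eE].
  by rewrite cardsU1 eE natrD addrK normr1.
- by rewrite expr1n mul1r expect_edges.
Qed.

Definition isolated_verts E := [set v | E :&: touching [set v] == set0].

Lemma touchingP T e : reflect (e \in pairs n /\ exists2 v, v \in T & v \in e)
  (e \in touching T).
Proof.
rewrite [e \in touching T]inE; apply: (iffP andP) => [[h eD]|[eD [v vT ve]]].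
  split => //; move: h; rewrite [e \in induced _ _]inE eD /= => /subsetPn[v ve].
  by rewrite inE negbK => vT; exists v.
split => //; apply/negP => /inducedP[_ /subsetP /(_ v ve)].
by rewrite inE vT.
Qed.

Lemma card_star v : #|touching [set v]| = n.-1.
Proof.
apply/eqP; rewrite -(eqr_nat R) card_touching cards1.
have n0 : (0 < n)%N by apply: leq_ltn_trans (ltn_ord v).
by rewrite -[in N](prednK n0) -natr1; apply/eqP; field.
Qed.

Lemma isolated_card E : E \subset pairs n -> #|E| = #|induced E (~: isolated_verts E)|.
Proof.
move=> Ep; apply/eqP; rewrite eq_sym eqn_leq subset_leq_card /=; last first.
  by apply/subsetP => e /inducedP[].
apply: subset_leq_card; apply/subsetP => e eE; apply/inducedP; split => //.
apply/subsetP => v ve; rewrite !inE; apply/set0Pn; exists e.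
by rewrite inE eE; apply/touchingP; split; [exact: (subsetP Ep)|exists v; rewrite ?set11].
Qed.

(** Only the two ends of the added edge can cease to be isolated. *)
Lemma isolated_lip e E : e \in pairs n -> E \subset pairs n :\ e ->
  `|#|isolated_verts (e |: E)|%:R - #|isolated_verts E|%:R| <= 2 :> R.
Proof.
move=> eD _; have s1 : isolated_verts (e |: E) \subset isolated_verts E.
  apply/subsetP => v; rewrite !inE -!subset0; apply: subset_trans.
  by apply: setSI; apply: subsetUr.
have s2 : isolated_verts E \subset isolated_verts (e |: E) :|: e.
  apply/subsetP => v; rewrite 3!inE => /eqP h.
  rewrite setIUl h setU0; case: (boolP (v \in e)) => [|ve]; first by rewrite orbT.
  rewrite orbF setI_eq0 disjoints1; apply/touchingP => -[_ [w]].
  by rewrite inE => /eqP ->; apply/negP.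
have /eqP ce : #|e| == 2%N by move: eD; rewrite inE.
have h1 := subset_leq_card s1; have := subset_leq_card s2.
have [hU _] := leq_card_setU (isolated_verts (e |: E)) e.
move=> /leq_trans /(_ hU); rewrite ce; move: h1; clear.
move: #|isolated_verts E| #|isolated_verts _| => a b h1 h2.
rewrite ler_norml; have : (b%:R : R) <= a%:R by rewrite ler_nat.
have : (a%:R : R) <= (b + 2)%:R by rewrite ler_nat.
by rewrite natrD; lra.
Qed.

Lemma expect_isolated :
  expect p (pairs n) (fun E => #|isolated_verts E|%:R) = N * (1 - p) ^+ n.-1.
Proof.
(* As [0 ^+ 0 = 1], the power is the indicator that [v] is isolated, and [binexp_exp] evaluates its
   mean. *)
transitivity (expect p (pairs n) (fun E =>
    \sum_(v : 'I_n) (0 ^+ #|E :&: touching [set v]| : R))).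
  apply: eq_expect => E _; rewrite -sum1_card natr_sum big_mkcond /=.
  apply: eq_bigr => v _; rewrite inE -cards_eq0 expr0n.
  by case: (_ == _).
rewrite expect_sum (eq_bigr (fun=> (1 - p) ^+ n.-1)) => [|v _].
  by rewrite sumr_const card_ord mulr_natl.
rewrite (expect_card p (fun i => 0 ^+ i) (touching_sub _)) binexp_exp.
by rewrite mulr0 addr0 card_star.
Qed.

Lemma prob_isolated (a : R) : 0 < a ->
  Pr (fun E => #|isolated_verts E|%:R <= N * (1 - p) ^+ n.-1 - a) <=
  4 * p * #|pairs n|%:R / a ^+ 2.
Proof.
move=> a0; apply: le_trans (_ : 2 ^+ 2 * p * #|pairs n|%:R / a ^+ 2 <= _); last first.
  by rewrite (_ : 2 ^+ 2 = 4) // expr2; lra.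
apply: le_trans (chebyshev (L := 2) p01 _ a0 isolated_lip); last by [].
apply: le_prob => // E ED; rewrite expect_isolated => h.
by rewrite distrC ler_normr; apply/orP; left; lra.
Qed.

(** Edge by edge: one inside [T] counts twice on both sides, one with a single end in [T] counts
    once. *)
Lemma handshake E T : E \subset pairs n ->
  (\sum_(v in T) #|E :&: touching [set v]| <= #|E :&: touching T| + #|induced E T|)%N.
Proof.
move=> Ep.
have cE (A : {set {set 'I_n}}) : #|E :&: A| = (\sum_(e in E) (e \in A))%N.
  rewrite -sum1_card big_mkcond [RHS]big_mkcond /=; apply: eq_bigr => e _.
  by rewrite inE; do 2!case: (_ \in _).
have -> : #|induced E T| = (\sum_(e in E) (e \subset T))%N.
  rewrite -sum1_card big_mkcond [RHS]big_mkcond /=; apply: eq_bigr => e _.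
  by rewrite inE; case: (_ \in _); case: (_ \subset _).
rewrite cE; under eq_bigr do rewrite cE; rewrite exchange_big -big_split /=.
apply: leq_sum => e eE; have eD := subsetP Ep _ eE.
have st v : (e \in touching [set v]) = (v \in e).
  apply/touchingP/idP => [[_ [w]]|ve]; first by rewrite inE => /eqP ->.
  by split => //; exists v; rewrite ?set11.
under eq_bigr do rewrite st.
have [x [y [xy eE']]] := edgeP _ eD; subst e.
have -> : (\sum_(v in T) (v \in [set x; y]) = \sum_(v in [set x; y]) (v \in T))%N.
  rewrite big_mkcond [RHS]big_mkcond /=; apply: eq_bigr => v _.
  by do 2!case: (_ \in _).
rewrite big_setU1 /=; last by rewrite inE.
rewrite big_set1 set2_sub.
have -> : ([set x; y] \in touching T) = (x \in T) || (y \in T).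
  apply/touchingP/orP => [[_ [w wT]]|].
    by rewrite in_set2 => /orP[] /eqP <-; [left|right].
  by move=> xyT; split => //; case: xyT => h; [exists x|exists y]; rewrite // ?set21 ?set22.
by case: (x \in T); case: (y \in T).
Qed.
End Touching.

(** * The minimum degree *)

Section Stirling.
Context {R : realType}.
Implicit Types (t y : R).

(* Iterating [expR t - expR (- t) >= 2 (expR (t / 2) - expR (- (t / 2)))]. *)
Lemma expRB_ge (t : R) : 0 <= t -> 2 * t <= expR t - expR (- t).
Proof.
move=> t0; have h k : forall t : R, 0 <= t ->
    2 * t - t ^+ 2 * 2^-1 ^+ k <= expR t - expR (- t).
  elim: k => [|k IH] {t0}t t0.
    by have := expRN_le t0; have := expR_ge1Dx t; rewrite expr0; lra.
  have t20 : 0 <= t / 2 by lra.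
  have := IH _ t20; have := expR_gt0 (t / 2); have := expR_gt0 (- (t / 2)).
  have := expRxMexpNx_1 (t / 2).
  have -> : expR t = expR (t / 2) ^+ 2 by rewrite -expRM_natr; congr expR; lra.
  have -> : expR (- t) = expR (- (t / 2)) ^+ 2 by rewrite -expRM_natr; congr expR; lra.
  have : 1 - t / 2 <= expR (- (t / 2)) by apply: expR_ge1Dx.
  have : 1 + t / 2 <= expR (t / 2) by apply: expR_ge1Dx.
  have : 0 <= 2^-1 ^+ k :> R by rewrite exprn_ge0 // invr_ge0.
  rewrite [_ ^+ k.+1]exprS; set a := expR (t / 2); set b := expR (- (t / 2)); set c := _ ^+ k.
  move=> c0 ha hb ab b0 a0 hS.
  have s1 : 2 <= a + b by nra.
  have s2 : 0 <= a - b.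
    by rewrite subr_ge0 ler_expR; lra.
  have : a ^+ 2 - b ^+ 2 = (a - b) * (a + b) by ring.
  have := ler_wpM2l s2 s1; lra.
rewrite leNgt; apply/negP => gap.
pose g := 2 * t - (expR t - expR (- t)); have g0 : 0 < g by rewrite /g; lra.
have := upper_nthrootP (leqnn (Num.bound (t ^+ 2 / g))).
set k := Num.bound _; rewrite ltr_pdivrMr // => hk.
have := h k t t0; have k0 : 0 < 2 ^+ k :> R by rewrite exprn_gt0.
have : t ^+ 2 * 2^-1 ^+ k < g by rewrite exprVn ltr_pdivrMr // mulrC.
by rewrite /g; lra.
Qed.

(** Apply [expRB_ge] to the logarithm of [y = (j + 1) / j], for which [y - 1 / y] equals
    [1 / j + 1 / (j + 1)]. *)
Lemma lnS_sub (j : nat) : (0 < j)%N ->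
  ln j.+1%:R - ln j%:R <= (j%:R^-1 + j.+1%:R^-1) / 2 :> R.
Proof.
move=> j0; have jR : 0 < j%:R :> R by rewrite ltr0n.
have j1R : 0 < j.+1%:R :> R by rewrite ltr0n.
rewrite -ln_div ?posrE //; set y : R := j.+1%:R / j%:R.
have y0 : 0 < y by rewrite divr_gt0.
have ly : 0 <= ln y by apply: ln_ge0; rewrite ler_pdivlMr // mul1r ler_nat.
have yE : y - y^-1 = j%:R^-1 + j.+1%:R^-1.
  by rewrite /y -natr1; field; rewrite natr1 !gt_eqF.
by have := expRB_ge ly; rewrite expRN !lnK ?posrE // yE; set z := _ + _; lra.
Qed.

Lemma stirling_lower (j : nat) : (0 < j)%N ->
  (j%:R + 2^-1) * ln j%:R - j%:R <= ln j`!%:R :> R.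
Proof.
(* The extra term absorbs the error of [lnS_sub] in the induction:
   [(x + 1 / 2) (1 / x + 1 / (x + 1)) / 2] exceeds 1 by exactly [1 / (4 x) - 1 / (4 (x + 1))]. *)
suff h : (0 < j)%N -> (j%:R + 2^-1) * ln j%:R - j%:R + (4 * j%:R)^-1 <= ln j`!%:R :> R.
  move=> j0; apply: le_trans (h j0); rewrite lerDl invr_ge0 mulr_ge0 //.
elim: j => // -[_ _|j IH _]; first by rewrite (_ : (1`!)%N = 1%N) // ln1; lra.
have j0 : 0 < j.+1%:R :> R by rewrite ltr0n.
have j1 : 0 < j.+2%:R :> R by rewrite ltr0n.
have f0 : 0 < j.+1`!%:R :> R by rewrite ltr0n fact_gt0.
rewrite factS natrM lnM ?posrE //.
have := IH isT; have := lnS_sub (ltn0Sn j).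
have x0 : 0 <= j.+1%:R + 2^-1 :> R by rewrite addr_ge0 // ?invr_ge0 // ltW.
move/(ler_wpM2l x0).
have id (x : R) : 0 < x -> (x + 2^-1) * ((x^-1 + (x + 1)^-1) / 2) =
    1 + (4 * x)^-1 - (4 * (x + 1))^-1.
  move=> {}x0; field; apply/andP; split; rewrite gt_eqF //; lra.
rewrite -[j.+2%:R]natr1 (id _ j0).
set a := ln _; set b := ln _; set c := ln _; set u := (4 * _)^-1.
set v := (4 * _)^-1; move=> *; lra.
Qed.

(** Bound the binomial coefficient by [M ^ i / i!] and [1 - q] by [expR (- q)]. *)
Lemma binexp_le_poisson (q : R) (M i : nat) : 0 <= q <= 1 ->
  binexp q M (fun j => (j == i)%:R) <=
  (q * M%:R) ^+ i / i`!%:R * expR (q * i%:R - q * M%:R).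
Proof.
move=> /andP[q0 q1]; rewrite binexp_pred.
have f0 : 0 < i`!%:R :> R by rewrite ltr0n fact_gt0.
have [iM|iM] := leqP i M; last first.
  by rewrite bin_small // !mul0r !mulr_ge0 ?invr_ge0 ?exprn_ge0 ?expR_ge0 ?(ltW f0) // mulr_ge0.
apply: ler_pM; rewrite ?mulr_ge0 ?exprn_ge0 ?subr_ge0 //.
  rewrite ler_pdivlMr // mulrAC -natrM bin_ffact exprMn mulrC ler_wpM2l ?exprn_ge0 //.
  by rewrite -natrX ler_nat ffact_le_exp.
have -> : q * i%:R - q * M%:R = (- q) * (M - i)%:R by rewrite natrB //; ring.
rewrite expRM_natr; apply: lerXn2r; rewrite ?nnegrE ?subr_ge0 ?expR_ge0 //.
exact: expR_ge1Dx.
Qed.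

(** Up to index [j] each term is at least [4 / 3] times the preceding one, so the last term
    dominates as in a geometric series. *)
Lemma sum_exp_terms (mu : R) (j : nat) : 0 < mu -> 4 * j%:R <= 3 * mu ->
  \sum_(i < j.+1) mu ^+ i / i`!%:R <= 4 * (mu ^+ j / j`!%:R).
Proof.
move=> mu0; elim: j => [|j IH] hj.
  by rewrite big_ord1 /= expr0 fact0 divr1; lra.
have jR : 4 * j%:R <= 3 * mu by move: hj; rewrite -natr1; lra.
rewrite big_ord_recr /=; have := IH jR; set S := \sum_(i < _) _.
have f0 : 0 < j`!%:R :> R by rewrite ltr0n fact_gt0.
have j0 : 0 < j.+1%:R :> R by rewrite ltr0n.
set a := mu ^+ j / _ => hS.
have -> : mu ^+ j.+1 / j.+1`!%:R = a * mu / j.+1%:R.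
  by rewrite /a exprS factS natrM invfM; ring.
have a0 : 0 <= a by rewrite divr_ge0 ?exprn_ge0 // ltW.
have : 4 * a <= 3 * (a * mu / j.+1%:R).
  rewrite -ler_pdivrMl // -[X in _ <= X]mulrA mulrA.
  rewrite [X in _ <= X](_ : _ = a * (mu / j.+1%:R)); last by ring.
  rewrite [X in X <= _](_ : _ = a * (4 / 3)); last by field.
  by rewrite ler_wpM2l // ler_pdivlMr //; lra.
by set z := a * mu / _; lra.
Qed.

Lemma ln2_lt1 : ln 2 < 1 :> R.
Proof.
rewrite -ltr_expR lnK ?posrE //.
by have := expR_gt1Dx (oner_neq0 R); lra.
Qed.

Lemma ln2_gt0 : 0 < ln 2 :> R.
Proof. by apply: ln_gt0; lra. Qed.

(** This is the exponential rate of the lower tail at half the mean: by Stirling,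
    [expR (- mu) mu ^ j / j!] at [j = mu / 2] is [expR (- mu (1 - ln 2) / 2)] up to a factor of
    order [1 / sqrt mu]. *)
Lemma beta_inv : beta^-1 = (1 - ln 2) / 2 :> R.
Proof.
rewrite /beta ln_div ?posrE ?expR_gt0 // expRK.
have := ln2_lt1; set x := ln 2 => hx.
by field; rewrite gt_eqF // subr_gt0.
Qed.

Lemma betaV_gt0 : 0 < beta^-1 :> R.
Proof. by rewrite beta_inv; have := ln2_lt1; lra. Qed.

Lemma beta_ge2 : 2 <= beta :> R.
Proof.
have b0 := betaV_gt0; rewrite -[beta]invrK -div1r ler_pdivlMr // beta_inv.
by have := ln2_gt0; lra.
Qed.

(** The Poisson terms up to [j] sum to at most four times the last one, which Stirling's formula
    estimates; its factor [sqrt j] yields the term [ln mu / 2]. *)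
Lemma binexp_low_tail (q : R) (M j : nat) (mu := q * M%:R) : 0 <= q <= 1 ->
  0 < mu -> 4 * j%:R <= 3 * mu -> q * j%:R <= 1 ->
  mu / 2 <= j%:R <= mu / 2 + 4 ->
  binexp q M (fun i => (i <= j)%N%:R) <= 4 * expR (10 - mu / beta - ln mu / 2).
Proof.
move=> q01 mu0 j3 qj /andP[jl ju].
have jR : 0 < j%:R :> R by lra.
have j0 : (0 < j)%N by rewrite -(ltr0n R).
have f0 : 0 < j`!%:R :> R by rewrite ltr0n fact_gt0.
apply: (@le_trans _ _ (\sum_(i < j.+1) mu ^+ i / i`!%:R * expR (1 - mu))).
  apply: (@le_trans _ _ (\sum_(i < j.+1) binexp q M (fun k => (k == i)%:R))).
    rewrite -binexp_sum; apply: ler_binexp => // k _.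
    case: leqP => kj; last by rewrite sumr_ge0.
    have kj' : (k < j.+1)%N by [].
    by rewrite (bigD1 (Ordinal kj')) //= eqxx lerDl sumr_ge0.
  apply: ler_sum => i _; apply: le_trans (binexp_le_poisson _ _ q01) _.
  rewrite -/mu; apply: ler_wpM2l; first by rewrite divr_ge0 ?exprn_ge0 // ltW.
  rewrite ler_expR lerD2r; apply: le_trans qj; have /andP[q0 _] := q01.
  by rewrite ler_wpM2l // ler_nat -ltnS.
clearbody mu; rewrite -big_distrl /=.
apply: (@le_trans _ _ (4 * (mu ^+ j / j`!%:R) * expR (1 - mu))).
  by rewrite ler_wpM2r ?expR_ge0 // sum_exp_terms.
rewrite -!mulrA ler_wpM2l //.
rewrite -[mu ^+ j](@lnK R) ?posrE ?exprn_gt0 // lnXn //.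
rewrite -[j`!%:R](@lnK R) ?posrE // -expRN -!expRD ler_expR beta_inv.
have := stirling_lower j0.
have hm : ln mu <= ln 2 + ln j%:R.
  by rewrite -lnM ?posrE // ler_ln ?posrE ?mulr_gt0 //; lra.
have hj2 : ln mu - ln 2 <= ln j%:R by lra.
have := ler_wpM2l (ltW jR) hm.
have l2 := ln2_gt0; have l2' := ln2_lt1.
have : j%:R * (1 + ln 2) <= (mu / 2 + 4) * (1 + ln 2) by rewrite ler_wpM2r //; lra.
rewrite -[ln mu *+ j]mulr_natl; move: hj2.
set a := ln mu; set b := ln j%:R; set c := ln 2 in l2 l2' *.
set d := ln j`!%:R; lra.
Qed.

End Stirling.

Section LowDegree.
Context {R : realType}.
Variables (n : nat) (p w : R).
Hypothesis p01 : 0 <= p <= 1.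
Local Notation Pr := (prob p (pairs n)).
Let mu := p * n.-1%:R.

(* The factor [expR (- ln mu / 2)] of [binexp_low_tail] cancels the second order
   term of the threshold. *)
Lemma prob_low_degree :
  16 <= mu -> p * (mu / 2 + 4) <= 1 -> 1 <= ln (n%:R : R) -> 0 <= w ->
  mu = beta * (ln n%:R - ln (ln n%:R) / 2) + w ->
  Pr (fun E => exists2 v : 'I_n, true &
    (#|E :&: touching [set v]|%:R : R) <= mu / 2 + 4) <= 4 * expR (10 - w / beta).
Proof.
move=> mu16 pmu ln1 w0 muE; have /andP[p0 p1] := p01.
have n0 : 0 < n%:R :> R.
  by rewrite ltr0n lt0n; apply/eqP => n0; move: ln1; rewrite n0 ln0 //; lra.
pose x := mu / 2 + 4; have x0 : 0 <= x by rewrite /x; lra.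
pose j := Num.truncn x.
have jx : j%:R <= x by rewrite /j truncn_le.
have xj : x < j%:R + 1 by rewrite natr1 -truncn_le_nat.
apply: le_trans (prob_exists _ _ _ p01) _.
apply: (@le_trans _ _ (\sum_(v : 'I_n) 4 * expR (10 - mu / beta - ln mu / 2))).
  apply: ler_sum => v _.
  have mE : mu = p * #|touching [set v]|%:R by rewrite (card_star (R := R)).
  have := @binexp_low_tail R p #|touching [set v]| j p01; rewrite /= -mE => tail.
  have /tail : 0 < mu by lra.
  rewrite /x in jx xj; move=> {}tail; apply: le_trans (tail _ _ _); last 3 first.
  - lra.
  - by apply: le_trans pmu; rewrite ler_wpM2l.
  - by apply/andP; split; lra.
  rewrite -(expect_card p (fun i => (i <= j)%N%:R) (touching_sub _)).
  apply: prob_markov => // E ED h.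
  by rewrite (_ : (_ <= j)%N) // leqNgt truncn_lt_nat // -leNgt.
rewrite sumr_const card_ord -[X in X <= _]mulr_natl -{1}(lnK n0) mulrCA ler_wpM2l //.
rewrite -expRD ler_expR.
have b2 := @beta_ge2 R; have bV := @betaV_gt0 R.
have L0 : 0 < ln (n%:R : R) by lra.
have lnL : ln (ln (n%:R : R)) <= ln n%:R by have := ln_sublinear L0; lra.
have muL : ln n%:R <= mu.
  rewrite muE; have : 0 <= ln (n%:R : R) - ln (ln (n%:R : R)) / 2 by lra.
  by move/(ler_wpM2r)/(_ _ _ b2); lra.
have : ln (ln (n%:R : R)) <= ln mu by rewrite ler_ln ?posrE //; lra.
have -> : mu / beta = ln n%:R - ln (ln n%:R) / 2 + w / beta.
  by rewrite {1}muE mulrDl mulrAC divff ?mul1r // gt_eqF //; lra.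
lra.
Qed.
End LowDegree.

(** * Obstructions to small arboricity *)

Section Deterministic.
Context {R : realType}.
Variables (n : nat) (E : {set {set 'I_n}}).
Hypothesis Ep : E \subset pairs n.
Implicit Types (S U T : {set 'I_n}).

Lemma induced_small S : (#|S| <= 1)%N -> #|induced E S| = 0%N.
Proof.
move=> S1; apply/eqP; rewrite -leqn0 -(bin_small (n := #|S|) (m := 2)) //.
by rewrite -card_inside induced_setI // subset_leq_card // subsetIr.
Qed.

Lemma arboricity_gt k : (k < arboricity E)%N ->
  exists2 S : {set 'I_n}, (1 < #|S|)%N & (k * #|S|.-1 < #|induced E S|)%N.
Proof.
rewrite ltnNge => /(nash_williams k Ep) h; apply: contrapT => nS; apply: h => S S0.
have [S1|S1] := leqP #|S| 1; first by rewrite induced_small.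
by rewrite leqNgt; apply/negP => h; apply: nS; exists S.
Qed.

Lemma induced_leq S : S != set0 -> (#|induced E S| <= arboricity E * #|S|.-1)%N.
Proof. exact: (nash_williams _ Ep (leqnn _)). Qed.

Lemma induced_setT : induced E setT = E.
Proof. by apply/setP => e; rewrite inE subsetT andbT. Qed.

Lemma leq_arboricity : (1 < n)%N -> (#|E| <= arboricity E * n.-1)%N.
Proof.
move=> n1; rewrite -{1}induced_setT -[n in n.-1]card_ord -cardsT induced_leq //.
by rewrite -card_gt0 cardsT card_ord ltnW.
Qed.

(** Replaces the integer ceiling by a natural number for the counting arguments; the arboricity is
    no smaller, by the Nash-Williams bound for the whole vertex set. *)
Lemma ceil_ratioP : (1 < n)%N -> exists k : nat,
  [/\ @ceil_ratio R n E = k%:Z, (#|E| <= k * n.-1)%N,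
      ((k%:R - 1) * n.-1%:R < #|E|%:R :> R) & (k <= arboricity E)%N].
Proof.
move=> n1; rewrite /ceil_ratio; set x : R := #|E|%:R / n.-1%:R.
have n0 : 0 < n.-1%:R :> R by rewrite ltr0n -subn1 subn_gt0.
have x0 : 0 <= x by rewrite divr_ge0.
have c0 : 0 <= Num.ceil x by rewrite ceil_ge0 //; lra.
exists `|Num.ceil x|%N; have kE : (`|Num.ceil x|%N)%:R = (Num.ceil x)%:~R :> R.
  by rewrite -[LHS]/((Posz _)%:~R) gez0_abs.
have h1 : x <= (`|Num.ceil x|%N)%:R by rewrite kE ceil_ge.
have h2 : (`|Num.ceil x|%N)%:R - 1 < x.
  by rewrite kE; have := ceilB1_lt x; rewrite intrB.
split.
- by rewrite gez0_abs.
- by rewrite -(ler_nat R) natrM -ler_pdivrMr.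
- by rewrite -ltr_pdivlMr.
- have : (#|E|%:R : R) <= (arboricity E * n.-1)%:R by rewrite ler_nat leq_arboricity.
  rewrite natrM -ler_pdivrMr // => h; rewrite -ltnS -(ltr_nat R) -natr1.
  by rewrite -ltrBlDr; apply: lt_le_trans h.
Qed.

(** [T] is the complement of a set violating the bound for [j]. It is nonempty since the whole
    vertex set satisfies the bound, and it is not too large since sets of at most [n / 32] vertices
    satisfy it. *)
Lemma dense_complement k j K : (1 < n)%N -> (#|E| <= k * n.-1)%N -> (k <= j)%N ->
  (K <= j)%N ->
  (forall S, (1 < #|S|)%N -> (32 * #|S| <= n)%N -> (#|induced E S| <= K * #|S|.-1)%N) ->
  (j < arboricity E)%N ->
  exists T, [/\ (0 < #|T|)%N, (#|T| + 2 <= n)%N, (32 * #|T| <= 31 * n)%N &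
    (#|E :&: touching T| + j * (n - #|T|).-1 < #|E|)%N].
Proof.
move=> n1 Ek kj Kj small /arboricity_gt[S S1 hS].
have ST := cardsC S; rewrite card_ord in ST.
have S32 : (n < 32 * #|S|)%N.
  rewrite ltnNge; apply/negP => /(small S S1) h.
  have : (K * #|S|.-1 <= j * #|S|.-1)%N by rewrite leq_mul2r Kj orbT.
  by move=> /(leq_trans h); rewrite leqNgt hS.
have tE := card_setI_touching (~: S) Ep; rewrite setCK in tE.
have sE : (n - #|~: S|)%N = #|S| by rewrite -{1}ST addnK.
exists (~: S); rewrite sE; split.
- rewrite lt0n; apply/eqP => T0; move: hS; rewrite ltnNge => /negP; apply.
  rewrite T0 addn0 in ST; apply: (@leq_trans #|E|).
    by apply: subset_leq_card; apply/subsetP => e /inducedP[].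
  by apply: leq_trans Ek _; rewrite ST leq_mul2r kj orbT.
- by move: S1 ST; clear; lia.
- by move: S32 ST; clear; lia.
- by rewrite -tE ltn_add2l.
Qed.

(** With [q = #|E| / (n - 1) <= j], more than [q (n - 1 - #|T|)] edges avoid [T], which leaves fewer
    than [q #|T|] edges touching it. *)
Lemma touching_le k j T (X : R) : (#|T| + 2 <= n)%N -> (#|E| <= k * n.-1)%N ->
  (k <= j)%N ->
  (#|E :&: touching T| + j * (n - #|T|).-1 < #|E|)%N ->
  #|E|%:R <= X * n.-1%:R -> #|E :&: touching T|%:R <= X * #|T|%:R.
Proof.
move=> Tn Ek kj hT EX.
have n1 : 0 < n.-1%:R :> R by rewrite ltr0n; move: Tn; clear; lia.
have sE : ((n - #|T|).-1)%:R = n.-1%:R - #|T|%:R :> R.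
  by rewrite -natrB; [congr (_%:R); move: Tn; clear; lia | move: Tn; clear; lia].
have s0 : 0 <= n.-1%:R - #|T|%:R :> R by rewrite -sE.
have h : (#|E :&: touching T|%:R + j%:R * (n.-1%:R - #|T|%:R) <= #|E|%:R :> R).
  by rewrite -sE -natrM -natrD ler_nat ltnW.
have kjR : (#|E|%:R : R) <= j%:R * n.-1%:R.
  by rewrite -natrM ler_nat (leq_trans Ek) // leq_mul2r kj orbT.
have t0 : 0 <= #|T|%:R :> R by [].
have e1 : #|E|%:R / n.-1%:R <= j%:R :> R by rewrite ler_pdivrMr.
have e2 : #|E|%:R / n.-1%:R <= X by rewrite ler_pdivrMr.
have e3 : #|E|%:R / n.-1%:R * n.-1%:R = #|E|%:R :> R by rewrite divfK ?gt_eqF.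
have := ler_wpM2r s0 e1; have := ler_wpM2r t0 e2; move: e3 h.
set m := #|E|%:R; set N1 := n.-1%:R; set q := m / N1; set t := #|T|%:R.
set y := #|_|%:R; set jj := j%:R; clear; lra.
Qed.

Lemma touching_large k T : (#|T| + 2 <= n)%N -> (#|E| <= k * n.-1)%N ->
  (#|E :&: touching T| + k.+1 * (n - #|T|).-1 < #|E|)%N -> (n <= k.+1 * #|T|)%N.
Proof. by move=> Tn Ek; move: (#|E :&: _|) #|E| #|T| Tn Ek => y m t; clear; nia. Qed.

(** The degrees in [T] sum to at least [(k + 2) #|T|], while fewer than [k #|T|] edges touch [T]; by
    [handshake] more than [2 #|T|] edges lie inside [T]. *)
Lemma touching_dense k T : (#|T| + 2 <= n)%N -> (#|E| <= k * n.-1)%N ->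
  (#|E :&: touching T| + k * (n - #|T|).-1 < #|E|)%N ->
  (forall v, k.+2 <= #|E :&: touching [set v]|)%N ->
  (1 < #|T| /\ 2 * #|T|.-1 < #|induced E T|)%N.
Proof.
move=> Tn Ek hT deg; have := handshake T Ep.
have : (#|T| * k.+2 <= \sum_(v in T) #|E :&: touching [set v]|)%N.
  by rewrite -sum_nat_const; apply: leq_sum => v _.
move=> /leq_trans h /h {}h.
have [T1|T1] := leqP #|T| 1; last first.
  split => //; move: (#|E :&: _|) #|E| #|T| #|induced _ _| Tn Ek hT h T1 => y m t i.
  by clear; nia.
rewrite induced_small // addn0 in h.
move: (#|E :&: _|) #|E| #|T| Tn Ek hT h T1 => y m t; clear; nia.
Qed.

End Deterministic.

(** * The regime of unbounded average degree *)

Section DenseRegime.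
Context {R : realType}.
Variables (n : nat) (p dl : R).
Hypotheses (p01 : 0 <= p <= 1) (dl01 : 0 < dl <= 1).
Local Notation Pr := (prob p (pairs n)).
Local Notation N := (n%:R : R).
Local Notation d := (N * p).
(** The number of forests granted to small sets: large enough for [prob_dense_small], yet, for a
    typical number of edges, at most the ceiling of [#|E| / (n - 1)], which is about [d / 2]. *)
Let K0 := (Num.truncn (d / 4)).+1.
Let atypical_size (E : {set {set 'I_n}}) :=
  256^-1 * (p * #|pairs n|%:R) <= `|#|E|%:R - p * #|pairs n|%:R|.
Let dense_small (E : {set {set 'I_n}}) :=
  exists2 S : {set 'I_n}, (1 < #|S|)%N && (32 * #|S| <= n)%N &
                          (K0 * #|S|.-1 < #|induced E S|)%N.
Let few_touching (t1 : R) (E : {set {set 'I_n}}) :=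
  exists2 T : {set 'I_n}, [&& (0 < #|T|)%N, t1 <= #|T|%:R & 32 * #|T|%:R <= 31 * N] &
    #|E :&: touching T|%:R <= (1 + 256^-1) * d * #|T|%:R / 2.

Lemma natr_pred : (0 < n)%N -> n.-1%:R = N - 1.
Proof. by move=> n0; rewrite -[in N](prednK n0) -natr1 addrK. Qed.

Lemma mean_edges : (0 < n)%N -> p * #|pairs n|%:R = d / 2 * n.-1%:R.
Proof. by move=> n0; rewrite card_pairs bin2R; ring. Qed.

Lemma prob_edges_rel (e : R) : 0 < e -> 0 < p * #|pairs n|%:R ->
  Pr (fun E => e * (p * #|pairs n|%:R) <= `|#|E|%:R - p * #|pairs n|%:R|) <=
  (e ^+ 2 * (p * #|pairs n|%:R))^-1.
Proof.
move=> e0 q0; have eq0 := mulr_gt0 e0 q0.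
apply: (@le_trans _ _ (p * #|pairs n|%:R / (e * (p * #|pairs n|%:R)) ^+ 2)).
  exact: prob_edges.
move: q0; set q := p * _; clearbody q => {}q0.
by rewrite (_ : q / _ = (e ^+ 2 * q)^-1) //; field; rewrite !gt_eqF.
Qed.

Hypotheses (n64 : 64 <= N) (d8 : 8 <= d).

Lemma n_gt1 : (1 < n)%N.
Proof. by rewrite -(ltr_nat R); apply: lt_le_trans n64; rewrite ltr_nat. Qed.

Lemma prob_atypical : 1 <= dl * (256^-1 ^+ 2 * (p * #|pairs n|%:R)) ->
  Pr atypical_size <= dl.
Proof.
have N64 := n64; have D8 := d8.
move=> h; have n1 := n_gt1; have [dl0 _] := andP dl01.
have q0 : 0 < p * #|pairs n|%:R.
  rewrite mean_edges ?(ltnW n1) // mulr_gt0 //; first by lra.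
  by rewrite natr_pred ?(ltnW n1) //; lra.
have e0 : 0 < 256^-1 :> R by rewrite invr_gt0.
apply: le_trans (prob_edges_rel e0 q0) _.
by rewrite -div1r ler_pdivrMr // mulr_gt0 // exprn_gt0.
Qed.

Lemma prob_small (L : nat) : (0 < L)%N -> (2 * L <= K0)%N -> 64 <= dl * 4 ^+ L.-1 ->
  Pr dense_small <= 2 * dl.
Proof.
have N64 := n64; have D8 := d8.
move=> L0 LK hL; apply: (prob_dense_small p01 _ L0 LK) => //.
- exact: ltnW n_gt1.
- have : d / 4 < K0%:R by rewrite -truncn_le_nat.
  by lra.
- by have /andP[/ltW -> ->] := dl01.
Qed.

Lemma typical_bounds (E : {set {set 'I_n}}) : ~ atypical_size E ->
  #|E|%:R <= (1 + 256^-1) * d / 2 * n.-1%:R /\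
  (1 - 256^-1) * d / 2 * n.-1%:R <= #|E|%:R.
Proof.
have N64 := n64; have D8 := d8.
move=> /negP; rewrite -ltNge ltr_norml mean_edges ?(ltnW n_gt1) //.
by set x := #|E|%:R; set y := n.-1%:R; lra.
Qed.

Lemma typical_ratio (E : {set {set 'I_n}}) (k : nat) : ~ atypical_size E ->
  (#|E| <= k * n.-1)%N -> (k%:R - 1) * n.-1%:R < #|E|%:R :> R ->
  (K0 <= k)%N /\ (k%:R : R) < (1 + 256^-1) * d / 2 + 1.
Proof.
have N64 := n64; have D8 := d8.
move=> /typical_bounds[hu hl] k1 k2; have n1 := n_gt1.
have y0 : 0 < n.-1%:R :> R by rewrite ltr0n -subn1 subn_gt0.
have k1R : (#|E|%:R : R) <= k%:R * n.-1%:R by rewrite -natrM ler_nat.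
have c1 : (1 - 256^-1) * d / 2 <= k%:R.
  by rewrite -(ler_pM2r y0); apply: le_trans hl _.
have c2 : k%:R - 1 < (1 + 256^-1) * d / 2.
  by rewrite -(ltr_pM2r y0); apply: lt_le_trans hu.
split; last by lra.
rewrite -(ler_nat R) /K0 -natr1.
have : (Num.truncn (d / 4))%:R <= d / 4 by rewrite truncn_le; lra.
by lra.
Qed.

(** Outside the first two bad events only a large set can violate the bound for [j], and its
    complement meets at most about [d / 2] edges per vertex, as in [few_touching]. *)
Lemma touching_witness (E : {set {set 'I_n}}) (k j : nat) : E \subset pairs n ->
  ~ atypical_size E -> ~ dense_small E ->
  (#|E| <= k * n.-1)%N -> (k%:R - 1) * n.-1%:R < #|E|%:R :> R -> (k <= j)%N ->
  (j < arboricity E)%N ->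
  exists T : {set 'I_n}, [/\ (0 < #|T|)%N, (#|T| + 2 <= n)%N, 32 * #|T|%:R <= 31 * N,
    (#|E :&: touching T| + j * (n - #|T|).-1 < #|E|)%N &
    #|E :&: touching T|%:R <= (1 + 256^-1) * d * #|T|%:R / 2].
Proof.
have N64 := n64; have D8 := d8.
move=> Ep nA nS k1 k2 kj jA; have [Kk _] := typical_ratio nA k1 k2.
have [hu _] := typical_bounds nA.
have [|T [T0 Tn T31 hT]] := dense_complement Ep n_gt1 k1 kj (leq_trans Kk kj) _ jA.
  move=> S S1 S32; rewrite leqNgt; apply/negP => h; apply: nS; exists S => //.
  by rewrite S1.
exists T; split => //; first by rewrite -!natrM ler_nat.
have := touching_le Tn k1 kj hT hu.
by set x := #|_|%:R; set y := #|T|%:R; lra.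
Qed.

(** Arboricity above [k + 1] yields a [T] as in [touching_witness], and [touching_large] makes it
    large enough for the union bound. The total is [dl] for [atypical_size] and [2 * dl] for each of
    the other two events. *)
Lemma prob_arboricity_gap (L : nat) :
  1 <= dl * (256^-1 ^+ 2 * (p * #|pairs n|%:R)) ->
  (0 < L)%N -> (2 * L <= K0)%N -> 64 <= dl * 4 ^+ L.-1 ->
  32 * d * expR (- (rate * d)) <= dl ->
  Pr (fun E => ~ ((arboricity E)%:Z = @ceil_ratio R n E \/
                  (arboricity E)%:Z = @ceil_ratio R n E + 1)) <= 5 * dl.
Proof.
have N64 := n64; have D8 := d8.
move=> hA L0 LK hL hr; have n1 := n_gt1; have /andP[dl0 dl1] := dl01.
(* [touching_large] excludes sets [T] with fewer than [N / (4 d)] elements. *)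
pose t1 := N / (4 * d).
have d4 : 0 < 4 * d by lra.
apply: (@le_trans _ _ (Pr (fun E => atypical_size E \/ (dense_small E \/ few_touching t1 E)))).
  apply: le_prob => // E Ep h.
  have [?|nA] := pselect (atypical_size E); first by left.
  right; have [?|nS] := pselect (dense_small E); first by left.
  right; have [k [kE k1 k2 kA]] := ceil_ratioP (R := R) Ep n1.
  have [_ k3] := typical_ratio nA k1 k2.
  have kA' : (k.+1 < arboricity E)%N.
    rewrite ltn_neqAle ltn_neqAle kA andbT; apply/andP; split; apply/eqP => kk; apply: h.
      by right; rewrite kE -kk -addn1 PoszD.
    by left; rewrite kE kk.
  have [T [T0 Tn T31 hT bT]] := touching_witness Ep nA nS k1 k2 (leqnSn k) kA'.
  exists T => //; rewrite T0 T31 andbT /= /t1 ler_pdivrMr //.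
  have := touching_large Tn k1 hT; rewrite -(ler_nat R) natrM -natr1.
  have t0 : 0 <= #|T|%:R :> R by [].
  have : k%:R + 1 <= 4 * d by lra.
  by move/(ler_wpM2r t0); lra.
apply: le_trans (prob_or _ _ _ p01) _.
apply: le_trans (lerD (prob_atypical hA) (prob_or _ _ _ p01)) _.
have h3 : Pr (few_touching t1) <= 2 * dl.
  apply: prob_exists_touching => //.
  - by rewrite divr_gt0 //; lra.
  - by rewrite ltW.
  - rewrite /t1 [X in _ <= X]mulrA ler_pdivlMr //.
    have N0 : 0 <= N by lra.
    by have := ler_wpM2l N0 hr; set x := expR _; lra.
have := prob_small L0 LK hL; lra.
Qed.

(** Two cases. For [d >= D] the union bound covers every nonempty [T], since
    [expR (- (rate d)) <= 1 / N ^ 2]. For [d < D] the average degree is at most logarithmic, so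
    small sets are sparse and the minimum degree argument excludes a small [T]. *)
Lemma prob_arboricity_ne (L : nat) (w : R) (D := 2 / rate * ln N) :
  1 <= dl * (256^-1 ^+ 2 * (p * #|pairs n|%:R)) ->
  (0 < L)%N -> (2 * L <= K0)%N -> 64 <= dl * 4 ^+ L.-1 ->
  p * n.-1%:R = beta * (ln N - ln (ln N) / 2) + w -> 0 <= w ->
  16 <= p * n.-1%:R -> 1 <= ln N -> ln N <= d ->
  4 * expR (10 - w / beta) <= dl ->
  8 <= dl * N -> 512 * D ^+ 3 * expR (- (rate * ln N)) <= dl ^+ 2 ->
  D ^+ 2 <= N -> D <= dl * N ->
  Pr (fun E => ~ ((arboricity E)%:Z = @ceil_ratio R n E)) <= 9 * dl.
Proof.
have N64 := n64; have D8 := d8.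
move=> hA L0 LK hL muE w0 mu16 lnN1 lnNd hw h8 hD hD2 hD1.
have n1 := n_gt1; have /andP[dl0 dl1] := dl01; have /andP[p0 p1] := p01.
have r0 : 0 < rate :> R by rewrite /rate; lra.
have N0 : 0 < N by lra.
have [dD|Dd] := leP D d.
  apply: (@le_trans _ _ (Pr (fun E => atypical_size E \/ (dense_small E \/ few_touching 1 E)))).
    apply: le_prob => // E Ep h.
    have [?|nA] := pselect (atypical_size E); first by left.
    right; have [?|nS] := pselect (dense_small E); first by left.
    right; have [k [kE k1 k2 kA]] := ceil_ratioP (R := R) Ep n1.
    have kA' : (k < arboricity E)%N.
      by rewrite ltn_neqAle kA andbT; apply/eqP => kk; apply: h; rewrite kE kk.
    have [T [T0 Tn T31 hT bT]] := touching_witness Ep nA nS k1 k2 (leqnn k) kA'.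
    by exists T => //; rewrite T0 T31 andbT /= ler1n.
  apply: le_trans (prob_or _ _ _ p01) _.
  apply: le_trans (lerD (prob_atypical hA) (prob_or _ _ _ p01)) _.
  have h3 : Pr (few_touching 1) <= 2 * dl.
    apply: prob_exists_touching => //; first by rewrite ltW.
    have : expR (- (rate * d)) <= expR (- (2 * ln N)).
      rewrite ler_expR lerN2; have := ler_wpM2l (ltW r0) dD.
      by rewrite [rate * D](_ : _ = 2 * ln N) // /D; field; rewrite gt_eqF.
    have -> : expR (- (2 * ln N)) = N^-1 ^+ 2.
      by rewrite expRN mulrC expRM_natr lnK ?posrE // exprVn.
    have i0 : 0 < N^-1 by rewrite invr_gt0.
    have NN : N * N^-1 = 1 by rewrite divff ?gt_eqF.
    have h8' : 8 * N^-1 <= dl by rewrite ler_pdivrMr.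
    move=> h; rewrite mulr1; apply: le_trans h8'.
    have e2 : N * N^-1 ^+ 2 = N^-1 by rewrite expr2 mulrA NN mul1r.
    have := ler_wpM2l (ltW N0) h; rewrite e2; set x := expR _; set z := N^-1; lra.
  have := prob_small L0 LK hL; lra.
(* Sets with fewer than [t1] elements, for which the union bound fails, are
   excluded by [touching_dense]. *)
pose t1 := 8 * N * expR (- (rate * d)) / dl.
have t10 : 0 < t1 by rewrite /t1 divr_gt0 // !mulr_gt0 // expR_gt0.
(* Excluding this event keeps [#|E|] within [n - 1] of its mean, so that [k] is less than
   [d / 2 + 2]. *)
pose many (E : {set {set 'I_n}}) := n.-1%:R <= `|#|E|%:R - p * #|pairs n|%:R|.
pose lowdeg (E : {set {set 'I_n}}) := exists2 v : 'I_n, true &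
    (#|E :&: touching [set v]|%:R : R) <= p * n.-1%:R / 2 + 4.
pose dense2 (E : {set {set 'I_n}}) :=
  exists2 S : {set 'I_n}, (1 < #|S|)%N && (#|S|%:R <= t1)%R &
                          (2 * #|S|.-1 < #|induced E S|)%N.
have y1 := natr_pred (ltnW n1).
apply: (@le_trans _ _ (Pr (fun E => (atypical_size E \/ (dense_small E \/ few_touching t1 E))
    \/ (many E \/ (lowdeg E \/ dense2 E))))).
  apply: le_prob => // E Ep h.
  have [?|nA] := pselect (atypical_size E); first by left; left.
  have [?|nS] := pselect (dense_small E); first by left; right; left.
  have [k [kE k1 k2 kA]] := ceil_ratioP (R := R) Ep n1.
  have kA' : (k < arboricity E)%N.
    by rewrite ltn_neqAle kA andbT; apply/eqP => kk; apply: h; rewrite kE kk.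
  have [T [T0 Tn T31 hT bT]] := touching_witness Ep nA nS k1 k2 (leqnn k) kA'.
  have [tT|tT] := leP t1 (#|T|%:R : R).
    by left; right; right; exists T => //; rewrite T0 T31 tT.
  right; have [?|nM] := pselect (many E); first by left.
  right; have [?|nL] := pselect (lowdeg E); first by left.
  suff deg v : (k.+2 <= #|E :&: touching [set v]|)%N.
    have [T1 dT] := touching_dense Ep Tn k1 hT deg.
    by right; exists T => //; rewrite T1 ltW.
  (* A degree of at most [k + 1] is below [d / 2 + 3], hence below [p (n - 1) / 2 + 4] as [p <= 1];
     this explains the constant 4 in [lowdeg]. *)
  rewrite ltnNge; apply/negP => hv; apply: nL; exists v => //.
  move: hv nM; rewrite -(ler_nat R) -natr1 => hv /negP.
  rewrite -ltNge ltr_norml mean_edges ?(ltnW n1) // => /andP[_ hM].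
  have y0 : 0 < n.-1%:R :> R by rewrite ltr0n -subn1 subn_gt0.
  have hk : k%:R - 1 < d / 2 + 1.
    rewrite -(ltr_pM2r y0); apply: lt_trans k2 _; move: hM.
    by clear - R n p dl p01 dl01 n64 d8; set z := #|E|%:R; set y := n.-1%:R; lra.
  move: hv hk p1; rewrite y1; set z := #|_|%:R; clear - R n p dl p01 dl01 n64 d8.
  by lra.
have h3 : Pr (few_touching t1) <= 2 * dl.
  apply: prob_exists_touching => //; first by rewrite ltW.
  by rewrite /t1 [X in _ <= X]mulrC divfK // gt_eqF.
have h4 : Pr many <= dl.
  have y0 : 0 < n.-1%:R :> R by rewrite ltr0n -subn1 subn_gt0.
  apply: (@le_trans _ _ (p * #|pairs n|%:R / n.-1%:R ^+ 2)).
    exact: prob_edges.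
  rewrite mean_edges ?(ltnW n1) //.
  have pdl : p <= dl.
    by rewrite -(ler_pM2l N0); lra.
  rewrite expr2 invfM mulrA mulfK ?gt_eqF // ler_pdivrMr //.
  have : N / 2 <= n.-1%:R by rewrite y1; lra.
  move/(ler_wpM2l p0); have := ler_wpM2r (ltW y0) pdl; set y := n.-1%:R; lra.
have h5 : Pr lowdeg <= dl.
  apply: le_trans hw; apply: prob_low_degree => //.
  rewrite y1 in mu16 *; apply: (@le_trans _ _ (p * d)).
    by rewrite ler_wpM2l //; lra.
  rewrite (_ : p * d = d ^+ 2 / N); last by field; rewrite gt_eqF.
  rewrite ler_pdivrMr // mul1r; apply: le_trans hD2.
  have d0 : 0 <= d by apply: le_trans D8.
  apply: lerXn2r; rewrite ?nnegrE //; last exact: ltW.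
  exact: le_trans d0 (ltW Dd).
have h6 : Pr dense2 <= 2 * dl.
  apply: (@prob_dense2 _ _ _ p01 D) => //.
  - exact: ltnW.
  - by lra.
  - exact: ltW.
  - by rewrite ltW.
  have D0 : 0 <= D ^+ 3 by rewrite exprn_ge0 //; lra.
  rewrite /t1 mulrA ler_pdivrMr //.
  have : expR (- (rate * d)) <= expR (- (rate * ln N)).
    by rewrite ler_expR lerN2 ler_wpM2l // ltW.
  move/(ler_wpM2l D0); move: hD; set x := expR _; set y := expR _.
  move=> hD /(ler_wpM2l (ltW N0)); have := ler_wpM2l (ltW N0) hD; lra.
have h12 := lerD (prob_atypical hA) (lerD (prob_small L0 LK hL) h3).
have h456 := lerD h4 (lerD h5 h6).
apply: le_trans (prob_or _ _ _ p01) _.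
have e1 := prob_or (pairs n) atypical_size (fun E => dense_small E \/ few_touching t1 E) p01.
have e2 := prob_or (pairs n) dense_small (few_touching t1) p01.
have e3 := prob_or (pairs n) many (fun E => lowdeg E \/ dense2 E) p01.
have e4 := prob_or (pairs n) lowdeg dense2 p01.
by move: e1 e2 e3 e4 h12 h456; clear - R n p dl p01 dl01 n64 d8; lra.
Qed.
End DenseRegime.

(** * The regime of bounded average degree *)

Section SparseRegime.
Context {R : realType}.
Variables (n : nat) (p : R).
Hypothesis p01 : 0 <= p <= 1.
Local Notation Pr := (prob p (pairs n)).
Local Notation N := (n%:R : R).
Local Notation d := (N * p).

Lemma mean_edges_ge (a : R) : 2 <= N -> 0 <= a <= d ->
  a * N / 4 <= p * #|pairs n|%:R.
Proof.
move=> N2 /andP[a0 ad]; have n0 : (0 < n)%N by rewrite -(ltr0n R); lra.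
rewrite mean_edges // natr_pred //.
have h1 : N / 2 <= N - 1 by lra.
have := ler_pM a0 (_ : 0 <= N / 2) ad h1; rewrite (_ : a * (N / 2) = a * N / 2); last by ring.
by move=> /(_ ltac:(lra)); lra.
Qed.

Lemma mean_edges_le (b : R) : (0 < n)%N -> d <= b -> p * #|pairs n|%:R <= b * N / 2.
Proof.
move=> n0 db; rewrite mean_edges // natr_pred //; have /andP[p0 _] := p01.
have N0 : 0 <= N by []; have := ler_wpM2r N0 db; have := mulr_ge0 N0 p0; lra.
Qed.

(** Outside the bad events more than [g N] vertices are isolated, so all edges lie on fewer than
    [(1 - g) N] vertices, which raises the lower bound [#|E| / N] by a constant factor. The upper
    bound comes from [prob_dense_const]. *)
Lemma prob_not_linear (a b : R) (K : nat) (g := expR (- (2 * b)) / 2) :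
  0 < a -> a <= d -> d <= b -> (4 <= K)%N -> 8 * b <= K%:R -> p <= 4^-1 ->
  2 <= N -> 4 <= g * N ->
  Pr (fun E => ~ ((1 + g / 2) * p * N / 2 <= (arboricity E)%:R :> R /\ (arboricity E <= K)%N)) <=
  (2 * b / g ^+ 2 + 64 / (g ^+ 2 * a) + 2) / N.
Proof.
move=> a0 ad db K4 Kb p4 N2 gN; have /andP[p0 p1] := p01.
have n1 : (1 < n)%N by rewrite -(ler_nat R).
have n0 := ltnW n1; have N0 : 0 < N by lra.
have g0 : 0 < g by rewrite /g divr_gt0 ?expR_gt0.
have g12 : g <= 2^-1.
  have : expR (- (2 * b)) <= 1 by rewrite expR_le1; lra.
  by rewrite /g; lra.
(* The expected share of isolated vertices is at least [2 g]; half of it is left for the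
   deviation. *)
have p1g : 2 * g <= (1 - p) ^+ n.-1.
  have h1 : expR (- (2 * p)) <= 1 - p.
    have p20 : 0 <= 2 * p by lra.
    by have := expRN_le p20; have := ler_wpM2l p0 p4; lra.
  have : expR (- (2 * p)) ^+ n.-1 <= (1 - p) ^+ n.-1.
    by rewrite lerXn2r ?nnegrE ?expR_ge0 //; lra.
  apply: le_trans; rewrite (_ : 2 * g = expR (- (2 * b))); last by rewrite /g; field.
  by rewrite -expRM_natr ler_expR natr_pred //; lra.
pose fewiso (E : {set {set 'I_n}}) := #|isolated_verts E|%:R <= N * (1 - p) ^+ n.-1 - N * g.
(* Small enough for [(1 + g / 2) (1 - g) <= (1 - e) ^ 2], where one factor [1 - e] pays for the
   deviation of [#|E|] and one for replacing [n - 1] by [n]. *)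
pose e := g / 4; have e0 : 0 < e by rewrite /e; lra.
pose atyp (E : {set {set 'I_n}}) :=
  e * (p * #|pairs n|%:R) <= `|#|E|%:R - p * #|pairs n|%:R|.
pose dense (E : {set {set 'I_n}}) :=
  exists2 S : {set 'I_n}, (1 < #|S|)%N & (K * #|S|.-1 < #|induced E S|)%N.
apply: (@le_trans _ _ (Pr (fun E => fewiso E \/ (atyp E \/ dense E)))).
  apply: le_prob => // E Ep h.
  have [?|nI] := pselect (fewiso E); first by left.
  right; have [?|nA] := pselect (atyp E); first by left.
  right; have [hK|/(arboricity_gt Ep)//] := leqP (arboricity E) K.
  exfalso; apply: h; split => //.
  have iso : N * g < #|isolated_verts E|%:R.
    move/negP: nI; rewrite -ltNge; apply: le_lt_trans.
    by have := ler_wpM2l (ltW N0) p1g; lra.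
  have hE : (1 - e) * (p * #|pairs n|%:R) <= #|E|%:R.
    by move/negP: nA; rewrite -ltNge ltr_norml => /andP[+ _]; set q := p * _; lra.
  have hU : (#|E|%:R : R) <= (arboricity E)%:R * (N - #|isolated_verts E|%:R).
    have cU := cardsC (isolated_verts E); rewrite card_ord in cU.
    rewrite (_ : N - _ = #|~: isolated_verts E|%:R); last first.
      by rewrite -[in N]cU natrD addrAC subrr add0r.
    rewrite (isolated_card Ep) -natrM ler_nat.
    have [->|U0] := eqVneq (~: isolated_verts E) set0.
      by rewrite cards0 induced_small ?cards0.
    by apply: leq_trans (induced_leq Ep U0) _; rewrite leq_mul2l leq_pred orbT.
  set A : R := (arboricity E)%:R in hU *; have A0 : 0 <= A by [].
  have h1 : (1 - e) * (p * #|pairs n|%:R) <= A * ((1 - g) * N).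
    apply: le_trans hE (le_trans hU _); apply: ler_wpM2l => //.
    by move: iso; set z := #|_|%:R; lra.
  have h2 : (1 - e) * N <= n.-1%:R.
    by rewrite natr_pred //; move: gN; rewrite /e; lra.
  have h3 : (1 - e) * d / 2 * ((1 - e) * N) <= A * (1 - g) * N.
    apply: le_trans (_ : (1 - e) * d / 2 * n.-1%:R <= _).
      by apply: ler_wpM2l => //; rewrite divr_ge0 // mulr_ge0 // ?/e; lra.
    by move: h1; rewrite mean_edges //; set y := n.-1%:R; lra.
  have h4 : (1 - e) * (1 - e) * (d / 2) <= A * (1 - g).
    by rewrite -(ler_pM2r N0); lra.
  have g1 : 0 < 1 - g by lra.
  rewrite -(ler_pM2r g1); apply: le_trans h4.
  have d20 : 0 <= d / 2 by lra.
  have : (1 + g / 2) * (1 - g) <= (1 - e) * (1 - e).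
    by have := sqr_ge0 e; have := sqr_ge0 g; rewrite /e; lra.
  by move/(ler_wpM2r d20); lra.
have h1 : Pr fewiso <= 2 * b / g ^+ 2 / N.
  have gN0 : 0 < N * g by rewrite mulr_gt0.
  apply: (@le_trans _ _ (4 * p * #|pairs n|%:R / (N * g) ^+ 2)); first exact: prob_isolated.
  rewrite (_ : 2 * b / g ^+ 2 / N = 2 * (b * N) / (N * g) ^+ 2); last first.
    by field; rewrite !gt_eqF.
  rewrite ler_wpM2r ?invr_ge0 ?exprn_ge0 ?(ltW gN0) //.
  by rewrite -mulrA; have := mean_edges_le n0 db; set q := p * _; lra.
have h2 : Pr atyp <= 64 / (g ^+ 2 * a) / N.
  have a01 : 0 <= a <= d by rewrite ltW.
  have q0 := mean_edges_ge N2 a01.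
  have aN : 0 < a * N / 4 by rewrite divr_gt0 // mulr_gt0.
  apply: (@le_trans _ _ (e ^+ 2 * (p * #|pairs n|%:R))^-1).
    by apply: prob_edges_rel => //; apply: lt_le_trans q0.
  have e20 : 0 < e ^+ 2 by rewrite exprn_gt0.
  rewrite (_ : 64 / _ / _ = (e ^+ 2 * (a * N / 4))^-1); last first.
    by rewrite /e; field; rewrite !gt_eqF.
  have q1 : 0 < p * #|pairs n|%:R by apply: lt_le_trans q0.
  by rewrite lef_pV2 ?posrE ?(mulr_gt0 e20) // ler_wpM2l // ltW.
have h3 : Pr dense <= 2 / N by apply: prob_dense_const => //; lra.
have e1 := prob_or (pairs n) fewiso (fun E => atyp E \/ dense E) p01.
have e2 := prob_or (pairs n) atyp dense p01.
rewrite 2!mulrDl -addrA.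
exact: le_trans e1 (lerD h1 (le_trans e2 (lerD h2 h3))).
Qed.

(* Vanishes iff the arboricity is at most [k], and is concentrated because adding
   an edge changes it by at most one. *)
Definition excess k (E : {set {set 'I_n}}) : nat :=
  \max_(S : {set 'I_n} | S != set0) (#|induced E S| - k * #|S|.-1).

Lemma leq_excess k (E : {set {set 'I_n}}) (S : {set 'I_n}) : S != set0 ->
  (#|induced E S| - k * #|S|.-1 <= excess k E)%N.
Proof.
exact: (@leq_bigmax_cond _ (fun S : {set 'I_n} => S != set0)
  (fun S => #|induced E S| - k * #|S|.-1)%N S).
Qed.

Lemma excess_lip k e (E : {set {set 'I_n}}) :
  `|(excess k (e |: E))%:R - (excess k E)%:R| <= 1 :> R.
Proof.
have iU S : (#|induced E S| <= #|induced (e |: E) S| <= #|induced E S|.+1)%N.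
  apply/andP; split.
    apply: subset_leq_card; apply/subsetP => f /inducedP[fE fS].
    by apply/inducedP; rewrite in_setU1 fE orbT.
  have : induced (e |: E) S \subset e |: induced E S.
    apply/subsetP => f /inducedP[]; rewrite !in_setU1 => /orP[->//|fE fS].
    by apply/orP; right; apply/inducedP.
  by move/subset_leq_card/leq_trans; apply; rewrite cardsU1; case: (_ \notin _).
have h1 : (excess k E <= excess k (e |: E))%N.
  apply/bigmax_leqP => S S0; apply: leq_trans (leq_excess k _ S0).
  by apply: leq_sub2r; have /andP[] := iU S.
have h2 : (excess k (e |: E) <= (excess k E).+1)%N.
  apply/bigmax_leqP => S S0; have := leq_excess k E S0.
  have /andP[_] := iU S; move: #|induced _ _| (excess k E) #|induced _ _| (k * _)%N.
  by clear; lia.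
rewrite ler_norml; have : (excess k (e |: E))%:R <= (excess k E).+1%:R :> R by rewrite ler_nat.
have : (excess k E)%:R <= (excess k (e |: E))%:R :> R by rewrite ler_nat.
by rewrite -natr1; lra.
Qed.

(** Take the least [k] for which arboricity at most [k] has probability at least [eta], raised to 1
    if it is 0. The excess over [k] vanishes with a probability exceeding its chance of deviating by
    [A], so its mean is below [A] and it rarely reaches [2 * A]. Sets violating the bound for
    [k + 1] are then small, and small sets are sparse. *)
Lemma two_point (A D eta : R) : (1 < n)%N -> 0 < p * #|pairs n|%:R -> 0 < A ->
  p * #|pairs n|%:R / A ^+ 2 < eta -> eta <= 1 ->
  1 <= D -> d <= D ->
  exists2 k, (0 < k)%N & forall dl, 0 <= dl <= 1 -> 64 * D ^+ 3 * (2 * A) <= dl * N ->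
  Pr (fun E => ~ (arboricity E = k \/ arboricity E = k.+1)) <=
  (eta + (p * #|pairs n|%:R)^-1) + (p * #|pairs n|%:R / A ^+ 2 + 2 * dl).
Proof.
move=> n1 q0 A0 hV eta1 D1 dD; set q := p * _ in q0 hV *; set V := q / _ in hV *.
have V0 : 0 <= V by rewrite /V divr_ge0 ?exprn_ge0 ?ltW.
have qV0 : 0 < q^-1 by rewrite invr_gt0.
pose P k := eta <= Pr (fun E => (arboricity E <= k)%N).
have exP : exists k, P k.
  exists (\max_(E : {set {set 'I_n}}) arboricity E); apply: le_trans eta1 _.
  rewrite -[X in X <= _](expect_cst p (pairs n) 1); apply: ler_expect => // E _.
  by rewrite asboolT // leq_bigmax.
case: (ex_minnP exP) => k0 Pk0 mink0; pose k := maxn k0 1.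
have k_gt0 : (0 < k)%N by rewrite /k leq_max orbT.
exists k => // e e01 hD.
have low : Pr (fun E => (arboricity E < k)%N) <= eta + q^-1.
  (* If [k0 = 0] then [k = 1], and arboricity below 1 means no edges: a deviation of [#|E|] by its
     whole mean. *)
  have [k00|k0p] := posnP k0.
    apply: (@le_trans _ _ (Pr (fun E => q <= `|#|E|%:R - p * #|pairs n|%:R|))).
      apply: le_prob => // E Ep; rewrite /k k00 ltnS leqn0 => /eqP A00.
      have := leq_arboricity Ep n1; rewrite A00 mul0n leqn0 => /eqP ->.
      by rewrite sub0r normrN ger0_norm // ltW.
    apply: (@le_trans _ _ (q / q ^+ 2)); first exact: prob_edges.
    rewrite expr2 invfM mulrA divff ?gt_eqF // mul1r lerDr.
    exact: ltW (le_lt_trans V0 hV).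
  have : ~~ P k0.-1.
    by apply/negP => /mink0; rewrite leqNgt prednK // leqnn.
  rewrite -ltNge => h; apply: (@le_trans _ _ eta); last by lra.
  apply: le_trans (ltW h); apply: le_prob => // E _.
  by rewrite /k (maxn_idPl k0p) -{1}(prednK k0p) ltnS.
pose f (E : {set {set 'I_n}}) : R := (excess k E)%:R.
have cheb : Pr (fun E => A <= `|f E - expect p (pairs n) f|) <= V.
  apply: le_trans (chebyshev (L := 1) p01 _ A0 _) _ => //.
    by move=> e' E _ _; apply: excess_lip.
  by rewrite expr1n mul1r.
have mean : expect p (pairs n) f < A.
  rewrite ltNge; apply/negP => hA.
  have : P k by apply: le_trans Pk0 _; apply: le_prob => // E _ /leq_trans; apply; apply: leq_maxl.
  rewrite /P leNgt => /negP; apply; apply: le_lt_trans hV; apply: le_trans cheb.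
  apply: le_prob => // E Ep /(nash_williams k Ep) h.
  have -> : f E = 0.
    rewrite /f (_ : excess k E = 0%N) //; apply/eqP; rewrite -leqn0.
    by apply/bigmax_leqP => S S0; rewrite leqn0 subn_eq0 h.
  by rewrite sub0r normrN; apply: le_trans hA (ler_norm _).
pose dense2 (E : {set {set 'I_n}}) :=
  exists2 S : {set 'I_n}, (1 < #|S|)%N && (#|S|%:R <= 2 * A)%R &
                          (2 * #|S|.-1 < #|induced E S|)%N.
have hdense : Pr dense2 <= 2 * e by apply: (prob_dense2 p01 (ltnW n1) D1).
apply: (@le_trans _ _ (Pr (fun E => (arboricity E < k)%N \/
    (A <= `|f E - expect p (pairs n) f| \/ dense2 E)))).
  apply: le_prob => // E Ep h.
  have [?|kA] := ltnP (arboricity E) k; first by left.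
  right; have [?|hf] := leP A `|f E - expect p (pairs n) f|; first by left.
  have {hf} fA : f E < 2 * A by move: hf; rewrite ltr_norml => /andP[_]; lra.
  right; have kA' : (k.+1 < arboricity E)%N.
    rewrite ltn_neqAle ltn_neqAle kA andbT; apply/andP; split; apply/eqP => kk; apply: h.
      by right.
    by left.
  have [S S1 hS] := arboricity_gt Ep kA'.
  have S0 : S != set0 by rewrite -card_gt0 ltnW.
  (* More than [(k + 1) (#|S| - 1)] edges inside [S] give an excess of at least [#|S|], and
     [k + 1 >= 2] makes [S] an instance of [dense2]. *)
  have hx := leq_excess k E S0.
  exists S.
    rewrite S1 /=; apply: le_trans (ltW fA); rewrite ler_nat.
    move: S1 hS hx; rewrite mulSn; move: #|induced _ _| (excess k E) (k * _)%N => i x y.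
    by move: #|S| => z; clear; lia.
  by apply: leq_ltn_trans hS; rewrite leq_mul2r ltnS k_gt0 orbT.
have e1 := prob_or (pairs n) (fun E => (arboricity E < k)%N)
  (fun E => A <= `|f E - expect p (pairs n) f| \/ dense2 E) p01.
have e2 := prob_or (pairs n) (fun E => A <= `|f E - expect p (pairs n) f|) dense2 p01.
apply: le_trans e1 (lerD low (le_trans e2 (lerD cheb hdense))).
Qed.

End SparseRegime.

Local Open Scope classical_set_scope.
Local Open Scope ring_scope.

(** * Asymptotics *)

Section Limits.
Context {R : realType}.

(** The fourth power of [c x / 4 <= expR (c x / 4)]. *)
Lemma expR_decay (c x : R) : 0 < c -> 0 < x ->
  x ^+ 3 * expR (- (c * x)) <= (4 / c) ^+ 4 / x.
Proof.
move=> c0 x0; rewrite expRN ler_pdivrMr ?expR_gt0 // mulrAC ler_pdivlMr //.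
have -> : expR (c * x) = expR (c * x / 4) ^+ 4 by rewrite -expRM_natr; congr expR; field.
have h : c * x / 4 <= expR (c * x / 4) by have := expR_ge1Dx (c * x / 4); lra.
have -> : x ^+ 3 * x = (4 / c) ^+ 4 * (c * x / 4) ^+ 4 by field; rewrite gt_eqF.
apply: ler_wpM2l; first by rewrite exprn_ge0 // divr_ge0 // ltW.
by rewrite lerXn2r ?nnegrE ?expR_ge0 // divr_ge0 // mulr_ge0 // ltW.
Qed.

Lemma near_ln_ge (M : R) : \forall n \near \oo, M <= ln (n%:R : R).
Proof.
have := nbhs_infty_ger (expR M); apply: filterS => n hn.
rewrite -[M](@expRK R) ler_ln ?posrE ?expR_gt0 //.
by apply: lt_le_trans hn; apply: expR_gt0.
Qed.

Lemma aas_of_le (p : nat -> R) (P : forall n, {set {set 'I_n}} -> Prop) :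
  (forall n, 0 <= p n <= 1) ->
  (forall eps, 0 < eps <= 1 ->
     \forall n \near \oo, prob (p n) (pairs n) (fun E => ~ P n E) <= eps) ->
  aas p P.
Proof.
move=> hp h; apply/cvgrPdist_le => e e0.
have e01 : 0 < Num.min e 1 <= 1 by rewrite lt_min e0 ltr01 ge_min lexx orbT.
have := h _ e01; apply: filterS => n; rewrite gnp_probE prob_not le_min => /andP[hn _].
by rewrite ger0_norm // subr_ge0 prob_le1.
Qed.

Lemma exists_pow4 (dl : R) : 0 < dl -> exists2 L : nat, (0 < L)%N & 64 <= dl * 4 ^+ L.-1.
Proof.
move=> dl0; exists (Num.bound (64 / dl)).+1 => //=.
have := upper_nthrootP (leqnn (Num.bound (64 / dl))).
rewrite ltr_pdivrMr // mulrC => /ltW /le_trans; apply.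
by rewrite ler_pM2l // lerXn2r ?nnegrE //; lra.
Qed.

Variable p : nat -> R.
Hypothesis hp : forall n, 0 <= p n <= 1.

Lemma aas_arboricity_le1 : (fun n => p n * n%:R) @ \oo --> 0 ->
  aas p (fun n E => (arboricity E <= 1)%N).
Proof.
move=> /cvgrPdist_le h; apply: aas_of_le => // e /andP[e0 e1].
have e32 : 0 < e / 32 by lra.
have := h _ e32; apply: filterS => n; rewrite sub0r normrN => hn.
have {}hn : n%:R * p n <= e / 32 by rewrite mulrC; apply: le_trans (ler_norm _) hn.
rewrite [X in _ <= X](_ : e = 2 * (e / 2)); last by lra.
have e21 : 0 <= e / 2 <= 1 by apply/andP; split; lra.
have hn2 : 16 * (n%:R * p n) <= e / 2 by lra.
apply: le_trans (prob_cyclic (hp n) e21 hn2).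
by apply: le_prob => // E Ep /negP; rewrite -ltnNge => /(arboricity_gt Ep).
Qed.

Lemma near_gap_conditions (dl : R) (L : nat) : 0 < dl <= 1 ->
  exists M : R, [/\ 64 <= M, 8 <= M & forall n, M <= n%:R -> M <= n%:R * p n ->
    1 <= dl * (256^-1 ^+ 2 * (p n * #|pairs n|%:R)) /\
    (2 * L <= (Num.truncn (n%:R * p n / 4)).+1)%N].
Proof.
move=> /andP[dl0 dl1]; have iq : 0 < 256^-1 ^+ 2 * dl by rewrite mulr_gt0 // exprn_gt0 // invr_gt0.
exists (64 + 8 * L%:R + (256^-1 ^+ 2 * dl)^-1).
have iq' : 0 < (256^-1 ^+ 2 * dl)^-1 by rewrite invr_gt0.
have L0 : 0 <= L%:R :> R by [].
split; [by lra|by lra|move=> n hN hd].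
have q0 : 8 * n%:R / 4 <= p n * #|pairs n|%:R.
  by apply: mean_edges_ge; [lra|apply/andP; split; lra].
split.
  have : (256^-1 ^+ 2 * dl)^-1 <= p n * #|pairs n|%:R by lra.
  move=> /(ler_wpM2l (ltW iq)); rewrite divff ?gt_eqF //.
  by move/le_trans; apply; rewrite [X in _ <= X]mulrCA [X in _ <= X]mulrA.
have : n%:R * p n / 4 < (Num.truncn (n%:R * p n / 4)).+1%:R by rewrite -truncn_le_nat.
move=> h; rewrite -(ler_nat R) natrM; apply/ltW; apply: le_lt_trans h; lra.
Qed.

Lemma aas_arboricity_gap : (fun n => p n * n%:R) @ \oo --> +oo ->
  aas p (fun n E => (arboricity E)%:Z = @ceil_ratio R n E \/
                    (arboricity E)%:Z = @ceil_ratio R n E + 1).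
Proof.
move=> /cvgryPge hd; apply: aas_of_le => // e /andP[e0 e1].
pose dl := e / 5; have dl01 : 0 < dl <= 1 by rewrite /dl; apply/andP; split; lra.
have [dl0 dl1] := andP dl01.
have [L L0 hL] := exists_pow4 dl0.
have [M [M64 M8 hM]] := near_gap_conditions L dl01.
have r0 : 0 < rate :> R by rewrite /rate; lra.
(* For [d >= M2], [expR_decay] gives [32 d expR (- (rate d)) <= dl]. *)
pose M2 := 32 * (4 / rate) ^+ 4 / dl.
have hd1 := hd (Num.max M M2); have hN1 := nbhs_infty_ger M.
apply: filterS2 hd1 hN1 => n; rewrite ge_max mulrC => /andP[h1 h2] h3.
have [c1 c2] := hM n h3 h1.
rewrite (_ : e = 5 * dl); last by rewrite /dl; lra.
apply: (@prob_arboricity_gap R n (p n) dl (hp n) dl01 _ _ L) => //.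
- exact: le_trans h3.
- exact: le_trans h1.
have d8 : 8 <= n%:R * p n by apply: le_trans h1.
set d := n%:R * p n in h1 h2 c2 d8 *; have d0 : 0 < d by lra.
have := expR_decay r0 d0; set x := expR _ => hx.
have dd : d <= d ^+ 3 by rewrite -[X in X <= _]expr1 ler_weXn2l //; lra.
have x0 : 0 <= x by apply: expR_ge0.
apply: (@le_trans _ _ (32 * ((4 / rate) ^+ 4 / d))).
  by have := ler_wpM2r x0 dd; lra.
rewrite mulrA ler_pdivrMr //.
by move: h2; rewrite /M2 ler_pdivrMr // [d * _]mulrC.
Qed.

(** Since [ln L <= L], the bracket is at least [L / 2], and [beta >= 2]. With [L = ln n] it bounds
    the mean degree at the threshold from below. *)
Lemma beta_mean_ge (L w : R) : 1 <= L -> 0 <= w -> L <= beta * (L - ln L / 2) + w.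
Proof.
move=> L1 w0; have L0 : 0 < L by lra.
have h : L / 2 <= L - ln L / 2 by have := ln_sublinear L0; lra.
have b2 := @beta_ge2 R; have L20 : 0 <= L / 2 by lra.
by have := ler_pM _ L20 b2 h => /(_ ltac:(lra)); lra.
Qed.

Lemma aas_arboricity_ceil :
  (exists w : nat -> R, w @ \oo --> +oo /\
      forall n : nat, p n * (n.-1)%:R
        = beta * (ln n%:R - ln (ln n%:R) / 2) + w n) ->
  aas p (fun n E => (arboricity E)%:Z = @ceil_ratio R n E).
Proof.
move=> [w [/cvgryPge hw hpw]]; apply: aas_of_le => // e /andP[e0 e1].
pose dl := e / 9; have dl01 : 0 < dl <= 1 by rewrite /dl; apply/andP; split; lra.
have [dl0 dl1] := andP dl01.
have [L L0 hL] := exists_pow4 dl0.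
have [M [M64 M8 hM]] := near_gap_conditions L dl01.
have r0 : 0 < rate :> R by rewrite /rate; lra.
pose C : R := 2 / rate; have C0 : 0 < C by rewrite /C divr_gt0.
(* Thresholds for [l = ln n], one for each condition on [D = C l]: the bounds on
   [D ^ 3 expR (- (rate l))], on [D ^ 2] and on [D], all by [expR_decay]. *)
pose M1 := 512 * C ^+ 3 * (4 / rate) ^+ 4 / dl ^+ 2.
pose M2 : R := C ^+ 2 * 4 ^+ 4.
pose M3 := C * 4 ^+ 4 / dl.
(* This makes [4 expR (10 - w / beta)], the bound on the probability of a low degree, at most
   [dl]. *)
have w1 := hw (Num.max 0 (beta * (10 - ln (dl / 4)))).
have l1 := near_ln_ge (Num.max M (Num.max M1 (Num.max M2 (Num.max M3 (8 / dl))))).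
apply: filterS2 w1 l1 => n; rewrite !ge_max => /andP[w0 w1].
set l := ln n%:R => /andP[lM /and4P[l1 l2 l3 l4]].
have l64 : 64 <= l by apply: le_trans lM.
have l0 : 0 < l by lra.
have N0 : 0 < n%:R :> R.
  rewrite ltr0n lt0n; apply/eqP => n0.
  by move: l64; rewrite /l n0 ln0 //; lra.
have NE : expR l = n%:R by rewrite lnK ?posrE.
have Nl : l < n%:R by apply: ln_sublinear.
have n0 : (0 < n)%N by rewrite -(ltr0n R).
have mul : l <= p n * n.-1%:R by rewrite hpw; apply: beta_mean_ge => //; lra.
have /andP[p0 p1] := hp n.
have dmu : p n * n.-1%:R <= n%:R * p n.
  by rewrite mulrC ler_wpM2r // ler_nat leq_pred.
have hMd : M <= n%:R * p n by apply: le_trans lM (le_trans mul dmu).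
have hMN : M <= n%:R by apply: le_trans lM (ltW Nl).
have [c1 c2] := hM n hMN hMd.
have ll : l ^+ 2 <= l ^+ 3 by rewrite ler_weXn2l //; lra.
have ll1 : l <= l ^+ 3 by rewrite -[X in X <= _]expr1 ler_weXn2l //; lra.
have dec1 : l ^+ 3 <= 4 ^+ 4 / l * n%:R.
  have := expR_decay (ltr01 : 0 < 1 :> R) l0; rewrite mul1r divr1 expRN NE.
  by rewrite ler_pdivrMr.
rewrite (_ : e = 9 * dl); last by rewrite /dl; lra.
apply: (@prob_arboricity_ne R n (p n) dl (hp n) dl01 _ _ L (w n)) => //.
- exact: le_trans hMN.
- exact: le_trans hMd.
- by apply: le_trans mul; lra.
- by rewrite -/l; lra.
- exact: le_trans mul dmu.
- have bV := @betaV_gt0 R; have b2 := @beta_ge2 R.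
  have wb : 10 - ln (dl / 4) <= w n / beta by rewrite ler_pdivlMr 1?mulrC //; lra.
  have dl4 : 0 < dl / 4 by lra.
  have : expR (10 - w n / beta) <= expR (ln (dl / 4)) by rewrite ler_expR; lra.
  by rewrite lnK ?posrE //; lra.
- by move: l4; rewrite ler_pdivrMr // => h; rewrite mulrC; apply: le_trans h _;
     rewrite ler_wpM2r ?(ltW dl0) // ltW.
- rewrite -/l -/C exprMn; have := expR_decay r0 l0; set x := expR _ => hx.
  have C30 : 0 <= 512 * C ^+ 3 by rewrite mulr_ge0 // exprn_ge0 // ltW.
  apply: (@le_trans _ _ (512 * C ^+ 3 * ((4 / rate) ^+ 4 / l))).
    by have := ler_wpM2l C30 hx; lra.
  rewrite mulrA ler_pdivrMr //; move: l1; rewrite /M1 ler_pdivrMr ?exprn_gt0 //.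
  by rewrite [l * _]mulrC.
- rewrite -/l -/C exprMn; have C20 : 0 <= C ^+ 2 by rewrite exprn_ge0 // ltW.
  apply: (@le_trans _ _ (C ^+ 2 * (4 ^+ 4 / l * n%:R))).
    by rewrite ler_wpM2l //; lra.
  have h : M2 / l <= 1 by rewrite ler_pdivrMr // mul1r.
  by have := ler_wpM2r (ltW N0) h; rewrite /M2 mul1r !mulrA.
- rewrite -/l -/C; apply: (@le_trans _ _ (C * (4 ^+ 4 / l * n%:R))).
    by rewrite ler_wpM2l ?(ltW C0) //; lra.
  have h : C * 4 ^+ 4 / l <= dl.
    by rewrite ler_pdivrMr // [dl * _]mulrC -ler_pdivrMr.
  by have := ler_wpM2r (ltW N0) h; rewrite !mulrA.
Qed.

Variables a b : R.
Hypotheses (a0 : 0 < a) (ab : a <= b).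
Hypothesis hab : \forall n \near \oo, a / n%:R <= p n /\ p n <= b / n%:R.

Lemma near_mean_degree : \forall n \near \oo, a <= n%:R * p n /\ n%:R * p n <= b.
Proof.
have := nbhs_infty_ger (1 : R); move: hab; apply: filterS2 => n [h1 h2] n1.
have n0 : 0 < n%:R :> R by lra.
by move: h1 h2; rewrite ler_pdivrMr // ler_pdivlMr // ![p n * _]mulrC.
Qed.

Lemma aas_arboricity_linear : exists c1 c2 : R, 0 < c1 /\ c1 <= c2 /\
  aas p (fun n E => (1 + c1) * p n * n%:R / 2 <= (arboricity E)%:R /\
                    (arboricity E)%:R <= (1 + c2) * p n * n%:R / 2).
Proof.
have A0 := a0; have AB := ab.
pose g : R := expR (- (2 * b)) / 2; have g0 : 0 < g by rewrite divr_gt0 ?expR_gt0.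
pose K := (4 + Num.truncn (8 * b)).+1.
have K4 : (4 <= K)%N by rewrite /K -addSn leq_addr.
have Kb : 8 * b <= K%:R.
  have : 8 * b < (Num.truncn (8 * b)).+1%:R by rewrite -truncn_le_nat.
  move/ltW/le_trans; apply; rewrite ler_nat /K; clear; lia.
have K0 : 0 <= K%:R :> R by [].
have Ka : 0 <= 2 * K%:R / a by rewrite divr_ge0 ?mulr_ge0 // ltW.
(* As [a <= n p], the constant bound [K] is at most [(2 K / a) n p / 2]. *)
exists (g / 2), (g / 2 + 2 * K%:R / a).
split; first by lra.
split; first by lra.
apply: aas_of_le => // e /andP[e0 e1].
pose C := 2 * b / g ^+ 2 + 64 / (g ^+ 2 * a) + 2.
have := nbhs_infty_ger (Num.max 2 (Num.max (4 / g) (Num.max (4 * b) (C / e)))).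
move: near_mean_degree; apply: filterS2 => n [ad db].
rewrite !ge_max => /and4P[N2 Ng Nb NC].
have N0 : 0 < n%:R :> R by lra.
have /andP[p0 p1] := hp n.
have p4 : p n <= 4^-1.
  by rewrite -(ler_pM2l N0); lra.
apply: (@le_trans _ _ (C / n%:R)); last first.
  by rewrite ler_pdivrMr // mulrC -ler_pdivrMr.
apply: le_trans (prob_not_linear (hp n) a0 ad db K4 Kb p4 N2 _); last first.
  by move: Ng; rewrite ler_pdivrMr // mulrC.
apply: le_prob => // E Ep h h2; apply: h; case: h2 => h1 h2; split => //.
have h3 : (arboricity E)%:R <= K%:R :> R by rewrite ler_nat.
apply: le_trans h3 _.
have Ka1 : 2 * K%:R / a * a = 2 * K%:R by rewrite divfK // gt_eqF.
have := ler_wpM2l Ka ad; rewrite Ka1.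
have g20 : 0 <= 1 + g / 2 by lra.
have := mulr_ge0 g20 (mulr_ge0 (ltW N0) p0); set z := _ / a; lra.
Qed.

Lemma aas_arboricity_two_point : exists k : nat -> nat, (forall n, (0 < k n)%N) /\
  aas p (fun n E => arboricity E = k n \/ arboricity E = (k n).+1).
Proof.
have A0 := a0; have AB := ab.
pose D : R := b + 1; have D1 : 1 <= D by rewrite /D; lra.
(* With deviation [A n = n / ln n] the Chebyshev bound is of order [(ln n) ^ 2 / n], below [eta n],
   while both [eta n] and [A n / n] tend to 0. *)
pose eta n : R := (b + 1) * 4 ^+ 4 / ln n%:R.
pose A n : R := n%:R / ln n%:R.
pose cond n := [/\ (1 + (b + 1) * 4 ^+ 4 <= ln (n%:R : R)),
  a <= n%:R * p n & n%:R * p n <= b].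
have exk n : exists k, (0 < k)%N /\ (cond n ->
    p n * #|pairs n|%:R / A n ^+ 2 < eta n /\
    (p n * #|pairs n|%:R)^-1 <= 4 / (a * ln n%:R) /\
    forall dl, 0 <= dl <= 1 -> 64 * D ^+ 3 * (2 * A n) <= dl * n%:R ->
  prob (p n) (pairs n) (fun E => ~ (arboricity E = k \/ arboricity E = k.+1)) <=
  (eta n + (p n * #|pairs n|%:R)^-1) + (p n * #|pairs n|%:R / A n ^+ 2 + 2 * dl)).
  (* Outside [cond] only positivity is claimed, so the value 1 is a default. *)
  have [[ln1 ad db]|nc] := pselect (cond n); last by exists 1%N.
  set l := ln n%:R in ln1 *.
  have B0 : 0 <= (b + 1) * 4 ^+ 4 by rewrite mulr_ge0 ?exprn_ge0 //; lra.
  have l1 : 1 <= l by lra.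
  have l0 : 0 < l by lra.
  have N0 : 0 < n%:R :> R.
    rewrite ltr0n lt0n; apply/eqP => n0.
    by move: l1; rewrite /l n0 ln0 //; lra.
  have NE : expR l = n%:R by rewrite lnK ?posrE.
  have N2 : 2 <= n%:R :> R by rewrite -NE; have := expR_ge1Dx l; lra.
  have Nl : l <= n%:R by rewrite ltW // ln_sublinear.
  have n1 : (1 < n)%N by rewrite -(ler_nat R).
  have a01 : 0 <= a <= n%:R * p n by rewrite ltW.
  have q0 := mean_edges_ge N2 a01.
  have q1 := mean_edges_le (hp n) (ltnW n1) db.
  have aN : 0 < a * n%:R / 4 by rewrite divr_gt0 // mulr_gt0.
  have qp : 0 < p n * #|pairs n|%:R by apply: lt_le_trans q0.
  have An0 : 0 < A n by rewrite divr_gt0.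
  have hV : p n * #|pairs n|%:R / A n ^+ 2 < eta n.
    apply: (@le_lt_trans _ _ (b * n%:R / 2 / A n ^+ 2)).
      by rewrite ler_wpM2r // invr_ge0 exprn_ge0 // ltW.
    have -> : b * n%:R / 2 / A n ^+ 2 = b / 2 * (l ^+ 2 / n%:R).
      by rewrite /A -/l; field; rewrite !gt_eqF.
    have dec : l ^+ 2 / n%:R <= 4 ^+ 4 / l.
      have := expR_decay (ltr01 : 0 < 1 :> R) l0; rewrite mul1r divr1 expRN NE.
      apply: le_trans; rewrite ler_wpM2r ?invr_ge0 ?(ltW N0) //.
      by rewrite ler_weXn2l.
    have b20 : 0 <= b / 2 by lra.
    apply: le_lt_trans (ler_wpM2l b20 dec) _.
    rewrite /eta -/l mulrA ltr_pM2r ?invr_gt0 // ltr_pM2r ?exprn_gt0 //; lra.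
  have eta1 : eta n <= 1 by rewrite /eta -/l ler_pdivrMr // mul1r; lra.
  have dD : n%:R * p n <= D by rewrite /D; lra.
  have [k k0 hk] := two_point (hp n) n1 qp An0 hV eta1 D1 dD.
  exists k; split => // _; split => //; split => //.
  apply: (@le_trans _ _ (a * n%:R / 4)^-1); first by rewrite lef_pV2.
  rewrite invfM invrK mulrC ler_wpM2l // lef_pV2 ?posrE ?mulr_gt0 // ler_wpM2l //.
  exact: ltW.
have [k hk] := choice exk; exists k; split => [n|]; first by case: (hk n).
apply: aas_of_le => // e /andP[e0 e1].
pose dl := e / 8.
pose B : R := (b + 1) * 4 ^+ 4.
have B0 : 0 < B by rewrite mulr_gt0 ?exprn_gt0 //; lra.
have := near_ln_ge (Num.max (1 + B) (Num.max (4 * B / e) (Num.max (16 / (a * e))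
  (128 * D ^+ 3 / dl)))).
move: near_mean_degree; apply: filterS2 => n [ad db].
rewrite !ge_max => /and4P[l1 l2 l3 l4].
have [_ /(_ (And3 l1 ad db))[hV [hq hP]]] := hk n.
set l := ln n%:R in l1 l2 l3 l4 hq hP hV.
have l0 : 0 < l by lra.
have N0 : 0 < n%:R :> R.
  rewrite ltr0n lt0n; apply/eqP => n0.
  by move: l1; rewrite /l n0 ln0 //; lra.
have dl01 : 0 <= dl <= 1 by rewrite /dl; apply/andP; split; lra.
apply: le_trans (hP dl dl01 _) _.
  rewrite /A -/l (_ : 64 * D ^+ 3 * _ = 128 * D ^+ 3 * n%:R / l); last first.
    by field; rewrite gt_eqF.
  have dl0 : 0 < dl by rewrite /dl; lra.
  have h : 128 * D ^+ 3 <= dl * l by rewrite [dl * _]mulrC -ler_pdivrMr.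
  by rewrite ler_pdivrMr // [X in _ <= X]mulrAC ler_wpM2r // ltW.
have he : eta n <= e / 4.
  rewrite /eta -/l -/B ler_pdivrMr // -ler_pdivrMl; last by lra.
  by move: l2; rewrite ler_pdivrMr // => h; rewrite mulrC ler_pdivrMr; lra.
have hq' : 4 / (a * l) <= e / 4.
  rewrite ler_pdivrMr ?mulr_gt0 //; move: l3; rewrite ler_pdivrMr ?mulr_gt0 //.
  by lra.
rewrite /dl; lra.
Qed.

End Limits.

Theorem theorem2p4 (R : realType) (p : nat -> R)
  (hp : forall n, 0 <= p n <= 1) :
  (* (i), first claim *)
  ((exists w : nat -> R, w @ \oo --> +oo /\
      forall n : nat, p n * (n.-1)%:R
        = beta * (ln n%:R - ln (ln n%:R) / 2) + w n) ->
    aas p (fun n E => (arboricity E)%:Z = @ceil_ratio R n E)) /\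
  (* (i), second claim *)
  ((fun n => p n * n%:R) @ \oo --> +oo ->
    aas p (fun n E => (arboricity E)%:Z = @ceil_ratio R n E \/
                      (arboricity E)%:Z = @ceil_ratio R n E + 1)) /\
  (* (ii) *)
  ((exists a b : R, 0 < a /\ a <= b /\
      \forall n \near \oo, a / n%:R <= p n /\ p n <= b / n%:R) ->
    (exists c1 c2 : R, 0 < c1 /\ c1 <= c2 /\
      aas p (fun n E => (1 + c1) * p n * n%:R / 2 <= (arboricity E)%:R /\
                        (arboricity E)%:R <= (1 + c2) * p n * n%:R / 2)) /\
    (exists k : nat -> nat, (forall n, (0 < k n)%N) /\
      aas p (fun n E => arboricity E = k n \/ arboricity E = (k n).+1))) /\
  (* (iii) *)
  ((fun n => p n * n%:R) @ \oo --> 0 ->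
    aas p (fun n E => (arboricity E <= 1)%N)).
Proof.
split; first exact: aas_arboricity_ceil.
split; first exact: aas_arboricity_gap.
split; last exact: aas_arboricity_le1.
move=> [a [b [a0 [ab hab]]]]; split.
  exact: aas_arboricity_linear a0 ab hab.
exact: aas_arboricity_two_point a0 ab hab.
Qed.
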